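(* There is an absolute constant $C>1$ such that the following holds. Let $f=f_n:\{-1,1\}^n\to\{0,1\}$ (a family of Boolean functions indexed by $n$) satisfy $\mathrm{MaxInf}(f)<1/C$ and $\mathrm{Var}[f]=2^{-o(n)}$ as $n\to\infty$. Let $\rho$ satisfy \[ \frac{C}{\mathrm{Var}[f]}\cdot\frac{\ln\ln(1/\mathrm{MaxInf}(f))}{\ln(1/\mathrm{MaxInf}(f))}\le\rho\le 1, \] let $\mathcal{R}$ be a random restriction that keeps exactly $\lceil\rho n\rceil$ variables alive, and let $p$ satisfy \[ \frac{8\,\mathrm{MaxInf}(f)^{\rho/C}}{\rho\,\mathrm{Var}[f]}\le p\le 1. \] Then for all sufficiently large $n$, \[ \Pr\left[\mathrm{Var}[f|_{\mathcal{R}}]\le\exp\left(-\frac{C}{\rho}\ln\frac{e}{\rho}\cdot\log\frac{8e}{p\,\mathrm{Var}[f]}\right)\right]\le p. \]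
   Context: Every $f:\{-1,1\}^n\to\mathbb{R}$ has a unique multilinear (Fourier) expansion $f(x)=\sum_{S\subseteq[n]}\hat f(S)\prod_{j\in S}x_j$. The influence of coordinate $i$ is $\mathrm{Inf}_i(f)=\sum_{S\ni i}\hat f(S)^2$ (for Boolean $f$ this equals the probability over uniform $x$ that flipping $x_i$ changes $f(x)$), and $\mathrm{MaxInf}(f)=\max_{i\in[n]}\mathrm{Inf}_i(f)$. $\mathrm{Var}[f]$ is the variance of $f(x)$ for $x$ uniform on $\{-1,1\}^n$. A random restriction keeping exactly $k$ variables alive is obtained by choosing a uniformly random set $A\subseteq[n]$ of size $k$ of alive coordinates and fixing each coordinate outside $A$ to an independent uniformly random value in $\{-1,1\}$; $f|_{\mathcal{R}}:\{-1,1\}^A\to\{0,1\}$ is the resulting restricted function, and $\mathrm{Var}[f|_{\mathcal{R}}]$ is its variance under the uniform distribution on $\{-1,1\}^A$. Here $\ln$ is the natural logarithm and $\log$ is the logarithm to base $2$. The notation $o(n)$ and ''sufficiently large $n$'' refer to $f$ being a family of functions indexed by $n$. *)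

(* Defs.v *)
From HB Require Import structures.
From mathcomp Require Import all_boot all_order all_algebra.
From mathcomp Require Import all_classical all_reals all_analysis.

Set Implicit Arguments.
Unset Strict Implicit.
Unset Printing Implicit Defensive.

Import Order.TTheory GRing.Theory Num.Theory.
Import numFieldNormedType.Exports.

Local Open Scope ring_scope.

(* The discrete cube {-1,1}^I: the bit b stands for the sign (-1)^b. *)
Definition cube (I : finType) := {ffun I -> bool}.

Definition coord (R : pzRingType) (I : finType) (x : cube I) (j : I) : R :=
  (-1) ^+ x j.

Definition chi (R : pzRingType) (I : finType) (S : {set I}) (x : cube I) : R :=
  \prod_(j in S) coord R x j.

(* {0,1}-valued functions, seen as real-valued ones. *)
Definition realf (R : pzRingType) (T : Type) (f : T -> bool) : T -> R :=
  fun x => (f x)%:R.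

Definition unif_exp (R : fieldType) (T : finType) (g : T -> R) : R :=
  (\sum_x g x) / #|T|%:R.

Definition unif_var (R : fieldType) (T : finType) (g : T -> R) : R :=
  unif_exp (fun x => (g x - unif_exp g) ^+ 2).

Definition unif_prob (R : fieldType) (T : finType) (E : pred T) : R :=
  #|E|%:R / #|T|%:R.

(* The coefficient of chi S in the multilinear expansion of g; see
   fourier_expansion and fourier_unique below. *)
Definition fourier (R : fieldType) (I : finType) (g : cube I -> R)
  (S : {set I}) : R := unif_exp (fun x => g x * chi R S x).

Definition influence (R : fieldType) (I : finType) (g : cube I -> R) (i : I)
  : R := \sum_(S : {set I} | i \in S) fourier g S ^+ 2.

(* Influences are nonnegative, so the default value 0 only matters when I is
   empty. *)
Definition max_inf (R : realFieldType) (I : finType) (g : cube I -> R) : R :=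
  \big[Num.max/0]_(i : I) influence g i.

Definition merge (I : finType) (A : {set I}) (y : cube {i : I | i \in A})
    (z : cube {i : I | i \notin A}) : cube I :=
  [ffun i => match boolP (i \in A) with
             | AltTrue iA => y (exist _ i iA)
             | AltFalse iNA => z (exist _ i iNA)
             end].

(* A is the set of alive coordinates, z the values of the fixed ones. *)
Definition restrict (R : Type) (I : finType) (g : cube I -> R) (A : {set I})
    (z : cube {i : I | i \notin A}) : cube {i : I | i \in A} -> R :=
  fun y => g (merge y z).

(* Probability that g restricted satisfies E: A is uniform among the sets of
   size k, and given A, z is uniform. *)
Definition restr_prob (R : fieldType) (I : finType) (g : cube I -> R) (k : nat)
    (E : forall A : {set I}, pred (cube {i : I | i \in A} -> R)) : R :=
  (\sum_(A : {set I} | #|A| == k)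
      unif_prob R (fun z : cube {i : I | i \notin A} => E A (restrict g z)))
  / #|[set A : {set I} | #|A| == k]|%:R.

Definition log2 (R : realType) (x : R) : R := ln x / ln 2.

Section FourierFacts.
Variables (R : realFieldType) (I : finType).
Implicit Types (g : cube I -> R) (S T : {set I}) (x y : cube I).

Lemma card_cube_neq0 : #|cube I|%:R != 0 :> R.
Proof. by rewrite pnatr_eq0 card_ffun card_bool expn_eq0. Qed.

Lemma chiE S x : chi R S x = \prod_i (if i \in S then coord R x i else 1).
Proof. by rewrite /chi big_mkcond. Qed.

Lemma sum_chi_set x y :
  \sum_(S : {set I}) chi R S x * chi R S y = #|cube I|%:R * (x == y)%:R.
Proof.
have -> : \sum_(S : {set I}) chi R S x * chi R S y
   = \prod_(i : I) (coord R x i * coord R y i + 1).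
  rewrite bigA_distr; apply: eq_bigr => S _.
  rewrite !chiE -big_split /=; apply: eq_bigr => i _.
  by case: ifP => // _; rewrite mulr1.
have [<-|/eqP nxy] := eqVneq x y.
  rewrite mulr1 card_ffun card_bool natrX -prodr_const.
  by apply: eq_bigr => i _; rewrite /coord -signr_addb addbb.
have [i nxyi] : exists i, x i != y i.
  apply/existsP; apply: contra_notT nxy.
  by rewrite negb_exists => /forallP h; apply/ffunP => i; move/eqP: (negPn (h i)).
rewrite mulr0 (bigD1 i) //= /coord -signr_addb addbC.
by move: nxyi; case: (x i) (y i) => [] [] // _; rewrite expr1 addNr mul0r.
Qed.

Lemma sum_chi_cube S T :
  \sum_(x : cube I) chi R S x * chi R T x = #|cube I|%:R * (S == T)%:R.
Proof.
pose F i (b : bool) : R :=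
  (if i \in S then (-1) ^+ b else 1) * (if i \in T then (-1) ^+ b else 1).
have -> : \sum_(x : cube I) chi R S x * chi R T x = \prod_i \sum_b F i b.
  rewrite bigA_distr_bigA; apply: eq_bigr => x _.
  by rewrite !chiE -big_split.
have FE i : \sum_b F i b = 2 * ((i \in S) == (i \in T))%:R.
  rewrite big_bool /F /=.
  by case: (i \in S) (i \in T) => [] [];
    rewrite ?expr1 ?expr0 ?mulrNN ?mulr1 ?mul1r ?addNr ?mulr0.
under eq_bigr do rewrite FE.
rewrite big_split /= prodr_const card_ffun card_bool natrX; congr (_ * _).
have [<-|/eqP nST] := eqVneq S T; first by rewrite big1 // => i _; rewrite eqxx.
have [i ni] : exists i, (i \in S) != (i \in T).
  apply/existsP; apply: contra_notT nST.
  by rewrite negb_exists => /forallP h; apply/setP => i; move/eqP: (negPn (h i)).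
by rewrite (bigD1 i) //= (negbTE ni) mul0r.
Qed.

Lemma fourier_expansion g x :
  g x = \sum_(S : {set I}) fourier g S * chi R S x.
Proof.
rewrite /fourier /unif_exp.
under eq_bigr do rewrite mulrAC mulr_suml.
rewrite -mulr_suml exchange_big /=.
under eq_bigr => y _.
  under eq_bigr do rewrite -mulrA.
  rewrite -mulr_sumr sum_chi_set.
  over.
rewrite (bigD1 x) //= big1 => [|y /negbTE ->]; last by rewrite !mulr0.
by rewrite eqxx mulr1 addr0 mulfK ?card_cube_neq0.
Qed.

Lemma fourier_unique g (c : {set I} -> R) :
  (forall x, g x = \sum_(S : {set I}) c S * chi R S x) -> c =1 fourier g.
Proof.
move=> gE S; rewrite /fourier /unif_exp.
under eq_bigr do rewrite gE mulr_suml.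
rewrite exchange_big /=.
under eq_bigr => T _.
  under eq_bigr do rewrite -mulrA.
  rewrite -mulr_sumr sum_chi_cube.
  over.
rewrite (bigD1 S) //= big1 => [|T /negbTE ->]; last by rewrite !mulr0.
by rewrite eqxx mulr1 addr0 mulfK ?card_cube_neq0.
Qed.

End FourierFacts.

(* Main.v *)
Require Import Defs.
From mathcomp Require Import all_boot all_order all_algebra.
From mathcomp Require Import all_classical all_reals all_analysis.
From mathcomp Require Import perm ring lra.

Import Order.TTheory GRing.Theory Num.Theory.
Import numFieldNormedType.Exports.

Local Open Scope ring_scope.

(** Expose the coordinates outside a random hidden set [L] one by one, and
    let [X] be the conditional mean of [f]. Conditioning the uniform law on
    [f = 1] gives coordinate [i] the bias [u_i = (X_{i+1} - X_i) / X_i]. As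
    long as [|u_i| <= r / 2], a player who controls only a random set [e] of
    density [r] can reproduce this law by playing with bias [u_i / r]. The
    mean then rarely becomes small, and the density of the player's choices
    with respect to the uniform law is typically at most [(p Var
    f)^(-O(1/r))]. Averaging over uniform choices instead, the mean of [f]
    on the subcube with alive set [L :|: e] is, up to probability [p], at
    least [(p Var f)^(O(1/r))]. The same applies to [1 - f].

    The increments of [X] are small because random restrictions of density
    [s] are hypercontractive from [L^2] to [L^(2 + s/2)], which gains a
    factor [MaxInf^(s/4)] over the sum of the squared derivatives of [f];
    this sum is at most [1 / s] once a further random set of density [s] has
    been averaged out.

    An alive set of exact size is handled by exchangeability: a restriction
    with a tiny mean still has, mostly, small means when the alive set
    shrinks. *)

(** * Uniform averages over a finite type *)

Section UnifExp.
Set Implicit Arguments.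
Unset Strict Implicit.
Variables (R : realFieldType) (T : finType).
Implicit Types g h : T -> R.

Lemma eq_unif_exp g h : g =1 h -> unif_exp g = unif_exp h.
Proof. by move=> gh; rewrite /unif_exp; under eq_bigr do rewrite gh. Qed.

Lemma unif_expD g h : unif_exp (fun x => g x + h x) = unif_exp g + unif_exp h.
Proof. by rewrite /unif_exp big_split mulrDl. Qed.

Lemma unif_expZ c g : unif_exp (fun x => c * g x) = c * unif_exp g.
Proof. by rewrite /unif_exp -mulr_sumr mulrA. Qed.

Lemma unif_expB g h : unif_exp (fun x => g x - h x) = unif_exp g - unif_exp h.
Proof. by rewrite /unif_exp big_split sumrN mulrBl. Qed.

Lemma unif_exp_sum (J : finType) (P : pred J) (F : J -> T -> R) :
  unif_exp (fun x => \sum_(j | P j) F j x) = \sum_(j | P j) unif_exp (F j).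
Proof. by rewrite /unif_exp exchange_big mulr_suml. Qed.

Lemma ge0_unif_exp g : (forall x, 0 <= g x) -> 0 <= unif_exp g.
Proof. by move=> g0; rewrite /unif_exp divr_ge0 ?sumr_ge0. Qed.

Lemma le_unif_exp g h : (forall x, g x <= h x) -> unif_exp g <= unif_exp h.
Proof.
by move=> gh; rewrite /unif_exp ler_wpM2r ?invr_ge0 ?ler0n //; apply: ler_sum.
Qed.

Lemma unif_exp_cst (c : R) : (0 < #|T|)%N -> unif_exp (fun _ : T => c) = c.
Proof.
move=> T0; rewrite /unif_exp big_const iter_addr addr0 -(mulr_natr c) mulfK //.
by rewrite pnatr_eq0 -lt0n.
Qed.

Lemma unif_exp_reindex (s : T -> T) g :
  involutive s -> unif_exp (fun x => g (s x)) = unif_exp g.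
Proof.
by move=> sK; rewrite /unif_exp [in RHS](reindex_inj (can_inj sK)).
Qed.

End UnifExp.

(** * Averaging out coordinates of the cube *)

Section CubeAverages.
Set Implicit Arguments.
Unset Strict Implicit.
Variables (R : realFieldType) (I : finType).
Implicit Types (g h : cube I -> R) (S T : {set I}) (x y : cube I) (i : I).

Lemma card_cube_gt0 : (0 < #|cube I|)%N.
Proof. by rewrite card_ffun card_bool expn_gt0. Qed.

Definition mix S x y : cube I := [ffun i => if i \in S then y i else x i].

(** The conditional expectation given the coordinates outside [S], kept as a function on the whole
    cube so that averages over different sets compose without changing types. *)
Definition avg S g : cube I -> R := fun x => unif_exp (fun y => g (mix S x y)).

(* [(x, y) |-> (mix S x y, mix S y x)] is an involution of the pairs. *)
Lemma unif_exp_mix S g :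
  unif_exp (fun x => unif_exp (fun y => g (mix S x y))) = unif_exp g.
Proof.
pose s (p : cube I * cube I) := (mix S p.1 p.2, mix S p.2 p.1).
have sK : involutive s.
  have mK x y : mix S (mix S x y) (mix S y x) = x.
    by apply/ffunP => i; rewrite !ffunE; case: (i \in S).
  by case=> x y; rewrite /s /= !mK.
transitivity ((\sum_(p : cube I * cube I) g p.1) / #|cube I|%:R / #|cube I|%:R).
  rewrite [in RHS](reindex_inj (can_inj sK)) /= /unif_exp -mulr_suml.
  by rewrite pair_bigA.
rewrite -(pair_bigA _ (fun x y => g x)) /= /unif_exp.
under eq_bigr do rewrite sumr_const -mulr_natr.
by rewrite -mulr_suml mulfK // pnatr_eq0 -lt0n card_cube_gt0.
Qed.

Lemma unif_exp_avg S g : unif_exp (avg S g) = unif_exp g.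
Proof. exact: unif_exp_mix. Qed.

Lemma eq_avg S g h : g =1 h -> avg S g =1 avg S h.
Proof. by move=> gh x; apply: eq_unif_exp => y. Qed.

Lemma avgD S g h x : avg S (fun x => g x + h x) x = avg S g x + avg S h x.
Proof. exact: unif_expD. Qed.

Lemma avgB S g h x : avg S (fun x => g x - h x) x = avg S g x - avg S h x.
Proof. exact: unif_expB. Qed.

Lemma avgZ S c g x : avg S (fun x => c * g x) x = c * avg S g x.
Proof. exact: unif_expZ. Qed.

Lemma avg_cst S (c : R) x : avg S (fun=> c) x = c.
Proof. exact: (unif_exp_cst _ card_cube_gt0). Qed.

Lemma le_avg S g h x : (forall x, g x <= h x) -> avg S g x <= avg S h x.
Proof. by move=> gh; apply: le_unif_exp. Qed.

Lemma avg_ge0 S g x : (forall x, 0 <= g x) -> 0 <= avg S g x.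
Proof. by move=> g0; apply: ge0_unif_exp. Qed.

Lemma avg_le1 S g x : (forall x, g x <= 1) -> avg S g x <= 1.
Proof. by move=> g1; rewrite -[leRHS](avg_cst S 1 x); apply: le_avg. Qed.

(** By [unif_exp_mix] a uniform point may itself be resampled on [T]; after that both sides evaluate
    [g] at the same point. *)
Lemma avg_avg S T g : avg S (avg T g) =1 avg (S :|: T) g.
Proof.
move=> x; rewrite /avg -(unif_exp_mix T (fun y => g (mix (S :|: T) x y))).
apply: eq_unif_exp => y; apply: eq_unif_exp => y'; congr g.
by apply/ffunP => i; rewrite !ffunE inE; case: (i \in S); case: (i \in T).
Qed.

Lemma avg_set0 g : avg finset.set0 g =1 g.
Proof.
move=> x; rewrite /avg (@eq_unif_exp _ _ _ (fun=> g x)).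
  exact: (unif_exp_cst _ card_cube_gt0).
by move=> y; congr g; apply/ffunP => i; rewrite ffunE inE.
Qed.

Lemma avg_setT g x : avg finset.setT g x = unif_exp g.
Proof.
by apply: eq_unif_exp => y; congr g; apply/ffunP => i; rewrite ffunE inE.
Qed.

Definition indep S (U : Type) (h : cube I -> U) :=
  forall x y, h (mix S x y) = h x.

Lemma indep_avg S T g : S \subset T -> indep S (avg T g).
Proof.
move=> /fintype.subsetP ST x y; apply: eq_unif_exp => z; congr g;
  apply/ffunP => i.
by rewrite !ffunE; case: ifP => // iT; case: ifP => // /ST; rewrite iT.
Qed.

Lemma avgM S h g x : indep S h -> avg S (fun x =>
  h x * g x) x = h x * avg S g x.
Proof.
by move=> Sh; rewrite -avgZ; apply: eq_unif_exp => y; rewrite Sh.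
Qed.

Lemma indep_sub S T (U : Type) (h : cube I -> U) :
  S \subset T -> indep T h -> indep S h.
Proof.
move=> ST Th x y; rewrite -(Th (mix S x y) x) -[RHS](Th x x); congr h.
apply/ffunP => i; rewrite !ffunE; case: ifPn => // iT.
by rewrite (negPf (contraNN (fintype.subsetP ST i) iT)).
Qed.

Definition flip i x : cube I := [ffun j => if j == i then ~~ x j else x j].

Lemma flipK i : involutive (flip i).
Proof.
by move=> x; apply/ffunP => j; rewrite !ffunE; case: eqP => // _; rewrite negbK.
Qed.

Lemma mix1E i x y : mix [set i] x y = if y i == x i then x else flip i x.
Proof.
apply/ffunP => j; rewrite !ffunE inE; case: (eqVneq j i) => [->|ji].
  by case: ifP => [/eqP->|] //; rewrite !ffunE eqxx; case: (x i) (y i) => [] [].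
by case: ifP => // _; rewrite ffunE (negPf ji).
Qed.

Lemma mix1_flip i x : mix [set i] x (flip i x) = flip i x.
Proof. by rewrite mix1E !ffunE eqxx; case: (x i). Qed.

Lemma avg1E i g x : avg [set i] g x = (g x + g (flip i x)) / 2.
Proof.
have two : (2 : R) != 0 by rewrite pnatr_eq0.
apply: (mulIf two); rewrite mulfVK // mulr_natr mulr2n.
rewrite {1}/avg -(unif_exp_reindex _ (flipK i)) /avg -unif_expD.
rewrite -[RHS](unif_exp_cst _ card_cube_gt0); apply: eq_unif_exp => y.
rewrite !mix1E !ffunE eqxx; case: (x i) (y i) => [] [] //=.
all: by rewrite addrC.
Qed.

Lemma indep1_flip i (U : Type) (h : cube I -> U) :
  (forall x, h (flip i x) = h x) <-> indep [set i] h.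
Proof.
split=> [hi x y|hi x]; first by rewrite mix1E; case: ifP.
by rewrite -[in LHS]mix1_flip hi.
Qed.

Lemma avg_sqr S g x : avg S g x ^+ 2 <= avg S (fun x => g x ^+ 2) x.
Proof.
have : 0 <= avg S (fun z => (g z - avg S g x) ^+ 2) x.
  by apply: avg_ge0 => z; apply: sqr_ge0.
have -> : avg S (fun z => (g z - avg S g x) ^+ 2) x =
    avg S (fun x => g x ^+ 2) x - avg S g x ^+ 2.
  set a := avg S g x.
  have -> : avg S (fun z => (g z - a) ^+ 2) x =
      avg S (fun z => (g z ^+ 2 + (- (2 * a)) * g z) + a ^+ 2) x.
    by apply: eq_avg => z; ring.
  by rewrite 2!avgD avgZ avg_cst -/a; ring.
by rewrite subr_ge0.
Qed.

End CubeAverages.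

(** * Random sets containing each coordinate independently *)

Section Bernoulli.
Set Implicit Arguments.
Unset Strict Implicit.
Variables (R : realFieldType) (I : finType).
Implicit Types (F G : {set I} -> R) (L : {set I}) (i : I).

Definition bern_weight (s : R) L : R := \prod_i (if i \in L then s else 1 - s).

Definition bern (s : R) F : R := \sum_L bern_weight s L * F L.

Lemma eq_bern s F G : F =1 G -> bern s F = bern s G.
Proof. by move=> FG; rewrite /bern; under eq_bigr do rewrite FG. Qed.

Lemma bernD s F G : bern s (fun L => F L + G L) = bern s F + bern s G.
Proof. by rewrite /bern -big_split; apply: eq_bigr => L _; rewrite mulrDr. Qed.

Lemma bernZ s c F : bern s (fun L => c * F L) = c * bern s F.
Proof. by rewrite /bern mulr_sumr; apply: eq_bigr => L _; rewrite mulrCA. Qed.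

Lemma bern_sum s (J : finType) (F : J -> {set I} -> R) :
  bern s (fun L => \sum_j F j L) = \sum_j bern s (F j).
Proof.
by rewrite /bern exchange_big; apply: eq_bigr => L _; rewrite mulr_sumr.
Qed.

(** Memberships of different coordinates are independent, so the mean of a product factors. *)
Lemma bern_prod s (a b : I -> R) :
  bern s (fun L => \prod_i (if i \in L then a i else b i)) =
  \prod_i (s * a i + (1 - s) * b i).
Proof.
rewrite bigA_distr; apply: eq_bigr => L _.
rewrite /bern_weight -big_split /=; apply: eq_bigr => i _.
by case: ifP.
Qed.

Lemma bern_cst s c : bern s (fun=> c) = c.
Proof.
rewrite -[RHS]mulr1 -[in LHS](mulr1 c) bernZ; congr (_ * _).
transitivity (\prod_(i : I) (s * 1 + (1 - s) * 1)); last first.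
  by rewrite big1 // => i _; ring.
rewrite -bern_prod; apply: eq_bern => L.
by rewrite big1 // => i _; case: ifP.
Qed.

Lemma bern_mem s i : bern s (fun L => (i \in L)%:R) = s.
Proof.
transitivity (\prod_j (s * 1 + (1 - s) * (j != i)%:R)); last first.
  rewrite (bigD1 i) //= eqxx big1 => [|j ji]; last by rewrite ji /=; ring.
  by rewrite /=; ring.
rewrite -bern_prod; apply: eq_bern => L.
rewrite (bigD1 i) //= eqxx big1 ?mulr1 => [|j ji]; last by rewrite ji;
  case: ifP.
by case: (i \in L).
Qed.

Lemma bern_card s : bern s (fun L => #|L|%:R) = s * #|I|%:R.
Proof.
rewrite (@eq_bern _ _ (fun L => \sum_i (i \in L)%:R)); last first.
  by move=> L; rewrite -sum1_card big_mkcond /= natr_sum;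
    apply: eq_bigr => i _; case: ifP.
rewrite bern_sum; under eq_bigr do rewrite bern_mem.
by rewrite sumr_const mulr_natr.
Qed.

(** Exchangeability: the weight of a set depends only on its size. *)
Lemma bern_imset s (p : {perm I}) F : bern s (fun L => F (p @: L)) = bern s F.
Proof.
rewrite /bern [in RHS](reindex_inj (imset_inj (@perm_inj _ p))) /=.
apply: eq_bigr => L _; congr (_ * _); rewrite /bern_weight.
rewrite [in RHS](reindex_inj (@perm_inj _ p)) /=; apply: eq_bigr => i _.
by rewrite mem_imset //; apply: perm_inj.
Qed.

Lemma sum_setU1 i G :
  \sum_L G L = \sum_(L : {set I} | i \notin L) (G L + G (i |: L)).
Proof.
rewrite big_split /= (bigID (fun L => i \in L)) /= addrC; congr (_ + _).
rewrite (reindex_onto (fun L => i |: L) (fun L => L :\ i)) /=; last first.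
  by move=> L iL; rewrite finset.setD1K.
apply: eq_bigl => L; rewrite finset.setU11 /=.
apply/eqP/idP => [E|iL]; last by rewrite finset.setU1K.
by rewrite -E finset.setD11.
Qed.

(** Conditioning on whether [i] lies in the random set; this drives the induction over coordinates
    in the hypercontractive inequality. *)
Lemma bern_split s i F :
  bern s F = (1 - s) * bern s (fun L => F (L :\ i))
             + s * bern s (fun L => F (i |: L)).
Proof.
rewrite -!bernZ -bernD /bern (sum_setU1 i) [in RHS](sum_setU1 i);
  apply: eq_bigr => L iL.
have wU L' : i \notin L' -> bern_weight s (i |: L') * (1 - s) = bern_weight s
  L' * s.
  move=> iL'; rewrite /bern_weight (bigD1 i) //= finset.setU11 [in RHS](bigD1
    i) //= (negPf iL').
  rewrite mulrAC [RHS]mulrAC [s * _]mulrC; congr (_ * _).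
  by apply: eq_bigr => j ji; rewrite !inE (negPf ji).
have -> : L :\ i = L by apply/finset.setP => j; rewrite !inE;
  case: eqP => // ->; rewrite (negPf iL).
rewrite finset.setU1K // finset.setUA finset.setUid.
transitivity (bern_weight s L * F L + bern_weight s (i |: L) * F (i |: L)) =>
  //.
have := wU L iL; set a := bern_weight s L; set b := bern_weight s (i |: L).
set A := F L; set B := F _ => ab.
have -> : a * ((1 - s) * A + s * B) + b * ((1 - s) * A + s * B) =
  a * A - (a * s) * A + (a * s) * B + (b * (1 - s)) * A + b * B - (b * (1 - s))
    * B by ring.
by rewrite ab; ring.
Qed.

Section Probability.
Variable s : R.
Hypotheses (s0 : 0 <= s) (s1 : s <= 1).

Lemma bern_weight_ge0 L : 0 <= bern_weight s L.
Proof. by apply: prodr_ge0 => i _; case: ifP => // _; rewrite subr_ge0. Qed.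

Lemma le_bern F G : (forall L, F L <= G L) -> bern s F <= bern s G.
Proof.
by move=> FG; apply: ler_sum => L _; rewrite ler_wpM2l ?bern_weight_ge0.
Qed.

End Probability.

Lemma unif_exp_bern s (T : finType) (F : T -> {set I} -> R) :
  unif_exp (fun x => bern s (F x)) = bern s (fun L => unif_exp (F^~ L)).
Proof.
rewrite /bern unif_exp_sum; apply: eq_bigr => L _; exact: unif_expZ.
Qed.

End Bernoulli.

(** * Hypercontractivity of random restrictions *)

Section Hypercontractivity.
Set Implicit Arguments.
Unset Strict Implicit.
Variable R : realType.

(** Convexity of the exponential between [ln x] and 0; the right side is the tangent of the power at
    1. *)
Lemma powR_le_affine (x k : R) : 0 <= x -> 0 <= k -> k <= 1 ->
  x `^ k <= 1 - k + k * x.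
Proof.
move=> x0 k0 k1; have [->|xn0] := eqVneq x 0.
  have [->|kn0] := eqVneq k 0; first by rewrite powRr0; lra.
  by rewrite powR0 // mulr0 addr0 subr_ge0.
have xp : 0 < x by rewrite lt_neqAle eq_sym xn0.
rewrite /powR (negPf xn0).
have := @convex_expR R (Itv01 k0 k1) (ln x) 0.
rewrite !convRE /= expR0 lnK ?posrE // mulr0 addr0 mulr1.
by rewrite /unstable.onem; lra.
Qed.

(** The power [1 + k]. Applied to squares it gives the exponent [2 + 2 * k], which is [2 + s / 2]
    for [k = s / 4]. *)
Definition pow1D (k u : R) : R := u * u `^ k.

Lemma pow1D_ge0 k u : 0 <= u -> 0 <= pow1D k u.
Proof. by move=> u0; rewrite mulr_ge0 ?powR_ge0. Qed.

Lemma le_pow1D k u v : 0 <= k -> 0 <= u -> u <= v -> pow1D k u <= pow1D k v.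
Proof.
move=> k0 u0 uv; rewrite ler_pM ?powR_ge0 //.
by apply: ge0_ler_powR => //; rewrite nnegrE (le_trans u0).
Qed.

(* Here [u1] and [u2] are the values of [|a + b|^2] and [|a - b|^2] for vectors
   with [A = |a|^2] and [B = |b|^2]. *)
Lemma pow1D_two_point (k s A B u1 u2 : R) :
  0 <= k -> 4 * k <= s -> s <= 1 -> 0 <= A -> 0 <= B -> 0 <= u1 -> 0 <= u2 ->
  u1 + u2 = 2 * (A + B) -> (u1 - u2) ^+ 2 <= 16 * (A * B) ->
  (1 - s) * ((pow1D k u1 + pow1D k u2) / 2) + s * pow1D k A <= pow1D k (A + B).
Proof.
move=> k0 ks s1 A0 B0 u10 u20 sumu difu; set m := A + B.
have m0 : 0 <= m by rewrite addr_ge0.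
have [mE|mn0] := eqVneq m 0.
  have -> : u1 = 0 by rewrite /m in mE; lra.
  have -> : u2 = 0 by rewrite /m in mE; lra.
  have -> : A = 0 by rewrite /m in mE; lra.
  by rewrite mE /pow1D !mul0r; lra.
have mp : 0 < m by rewrite lt_neqAle eq_sym mn0.
pose c := m `^ k; have c0 : 0 <= c by apply: powR_ge0.
(* Scaling by the mean [m] and taking the tangent bound at [u = m] makes the whole inequality
   quadratic in [u1] and [u2]. *)
have bnd u : 0 <= u -> pow1D k u <= c * (u * (1 - k + k * (u / m))).
  move=> u0; have -> : pow1D k u = c * (u * (u / m) `^ k).
    rewrite /pow1D mulrCA -powRM ?divr_ge0 //; congr (_ * _ `^ _).
    by rewrite mulrC divfK.
  rewrite ler_wpM2l // ler_wpM2l //; apply: powR_le_affine => //.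
    by rewrite divr_ge0.
  by lra.
have Ab : pow1D k A <= c * A.
  rewrite /pow1D mulrC ler_wpM2r //; apply: ge0_ler_powR => //.
  by rewrite /m; lra.
set d := A * B / m; have d0 : 0 <= d by rewrite !mulr_ge0 ?invr_ge0.
have dB : d <= B by rewrite /d ler_pdivrMr // mulrC ler_wpM2l // /m; lra.
have sq : (u1 ^+ 2 + u2 ^+ 2) / m <= 2 * m + 8 * d.
  rewrite ler_pdivrMr // mulrDl /d -(mulrA 8) divfK //.
  have : (u1 + u2) ^+ 2 = 4 * m ^+ 2 by rewrite sumu /m; ring.
  by move: difu; set x := A * B; nra.
have uu : (pow1D k u1 + pow1D k u2) / 2 <= c * (m + 4 * k * d).
  apply: (@le_trans _ _ (c * (((1 - k) * (u1 + u2) + k * ((u1 ^+ 2 + u2 ^+ 2) /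
    m)) / 2))).
    have := lerD (bnd u1 u10) (bnd u2 u20) => h.
    rewrite ler_pdivrMr //; apply: (le_trans h); rewrite le_eqVlt; apply/orP;
      left.
    by apply/eqP; field; rewrite mn0.
  rewrite ler_wpM2l // ler_pdivrMr // sumu -/m.
  have := ler_wpM2l k0 sq; lra.
apply: (@le_trans _ _ (c * ((1 - s) * (m + 4 * k * d) + s * A))).
  have h1 : (1 - s) * ((pow1D k u1 + pow1D k u2) / 2) <=
      (1 - s) * (c * (m + 4 * k * d)) by rewrite ler_wpM2l ?subr_ge0.
  have h2 : s * pow1D k A <= s * (c * A) by rewrite ler_wpM2l //; lra.
  by rewrite mulrDr !(mulrCA c); apply: lerD.
rewrite /pow1D mulrC ler_wpM2r //.
(* Averaging the coordinate out, with probability [s], loses [B]; since [4 * k <= s] and [d <= B],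
   this pays for the excess [4 * k * d] of the two-point mean. *)
have : (1 - s) * (4 * k * d) <= s * B.
  have h1 : 4 * k * d <= s * B by apply: ler_pM => //; rewrite mulr_ge0.
  have h2 : 0 <= 4 * k * d by rewrite mulr_ge0 // mulr_ge0.
  by apply: le_trans _ h1; rewrite ler_piMl //; lra.
by rewrite /m; lra.
Qed.

Variable I : finType.
Implicit Types (g h : cube I -> R) (S J L : {set I}) (x : cube I) (i : I).

Lemma avg_CauchySchwarz S g h x :
  avg S (fun x => g x * h x) x ^+ 2 <=
  avg S (fun x => g x ^+ 2) x * avg S (fun x => h x ^+ 2) x.
Proof.
set D := avg S (fun x => g x * h x) x.
set G := avg S (fun x => g x ^+ 2) x; set P := avg S (fun x => h x ^+ 2) x.
have G0 : 0 <= G by apply: avg_ge0 => z; apply: sqr_ge0.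
have P0 : 0 <= P by apply: avg_ge0 => z; apply: sqr_ge0.
have quad p q : 0 <= p ^+ 2 * G + (- (2 * p * q)) * D + q ^+ 2 * P.
  have -> : p ^+ 2 * G + (- (2 * p * q)) * D + q ^+ 2 * P =
      avg S (fun z => (p * g z - q * h z) ^+ 2) x.
    rewrite /G /D /P -!avgZ -!avgD; apply: eq_avg => z; ring.
  by apply: avg_ge0 => z; apply: sqr_ge0.
have [PE|Pn0] := eqVneq P 0.
  have [->|Dn0] := eqVneq D 0; first by rewrite expr2 mul0r mulr_ge0.
  (* If [P = 0] but [D] is not, this choice of [q] makes the quadratic form equal to -1. *)
  have := quad 1 ((G + 1) / (2 * D)).
  rewrite PE mulr0 addr0 expr1n mul1r mulr1.
  have -> : - (2 * ((G + 1) / (2 * D))) * D = - (G + 1) by field.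
  lra.
have Pp : 0 < P by rewrite lt_neqAle eq_sym Pn0.
have : 0 <= P * (G * P - D ^+ 2).
  have := quad P D; nra.
by rewrite pmulr_rge0 // subr_ge0.
Qed.

Lemma avg_flip S g i x : i \notin S ->
  avg S g (flip i x) = avg S (fun z => g (flip i z)) x.
Proof.
move=> iS; apply: eq_unif_exp => y; congr g; apply/ffunP => j.
by rewrite !ffunE; case: (eqVneq j i) => [->|] //; rewrite (negPf iS).
Qed.

(** Induction on [J], removing one coordinate [i]. If [i] is outside [L], the values at [x] and
    [flip i x] come from [a + b] and [a - b], the even part of [g] in [i] plus or minus the odd
    part; if [i] is in [L], only [a] survives. The induction hypothesis handles each case, and
    [pow1D_two_point] combines them. Fixing the base point [x] outside [J] is what lets the
    induction run. *)
Lemma bern_avg_hypercontractive (k s : R) J g x :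
  0 <= k -> 4 * k <= s -> s <= 1 ->
  bern s (fun L => avg J (fun z => pow1D k (avg (L :&: J) g z ^+ 2)) x) <=
  pow1D k (avg J (fun z => g z ^+ 2) x).
Proof.
move=> k0 ks s1; have s0 : 0 <= s by lra.
have [n] := ubnP #|J|; elim: n => // n IHn in J g x *; rewrite ltnS => Jn.
have [->|[i iJ]] := set_0Vmem J.
  rewrite avg_set0 (@eq_bern _ _ _ _ (fun=> pow1D k (g x ^+ 2))) ?bern_cst //.
  by move=> L; rewrite avg_set0 finset.setI0 avg_set0.
pose J0 := J :\ i.
have iJ0 : i \notin J0 by rewrite !inE eqxx.
have JE : J = i |: J0 by rewrite finset.setD1K.
have J0n : (#|J0| < n)%N by move: Jn; rewrite (cardsD1 i J) iJ.
pose a := avg [set i] g; pose b z := g z - a z.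
have aflip z : a (flip i z) = a z.
  by have [_] := indep1_flip i a; apply; apply: indep_avg.
have bflip z : b (flip i z) = - b z.
  by rewrite /b aflip /a avg1E; field.
have avgJ F z : avg J F z = (avg J0 F z + avg J0 F (flip i z)) / 2.
  by rewrite -avg1E avg_avg -JE.
rewrite (bern_split s i).
rewrite (@eq_bern _ _ _ _ (fun L =>
   (1 / 2) * (avg J0 (fun z => pow1D k (avg (L :&: J0) g z ^+ 2)) x
   + avg J0 (fun z => pow1D k (avg (L :&: J0) g z ^+ 2)) (flip i x))));
     last first.
  move=> L; have -> : (L :\ i) :&: J = L :&: J0.
    by apply/finset.setP => j; rewrite !inE; case: eqP; rewrite ?andbF.
  by rewrite avgJ; ring.
rewrite [X in _ + _ * X](@eq_bern _ _ _ _ (fun L =>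
   (1 / 2) * (avg J0 (fun z => pow1D k (avg (L :&: J0) a z ^+ 2)) x
   + avg J0 (fun z => pow1D k (avg (L :&: J0) a z ^+ 2)) (flip i x))));
     last first.
  move=> L; have -> : (i |: L) :&: J = (L :&: J0) :|: [set i].
    apply/finset.setP => j; rewrite !inE; case: (eqVneq j i) => [->|] /=.
      by rewrite iJ orbT.
    by rewrite orbF.
  rewrite avgJ; have -> : avg (L :&: J0 :|: [set i]) g = avg (L :&: J0) a.
    by apply/funext => z; rewrite /a avg_avg.
  by ring.
rewrite !bernZ !bernD.
(* The squared norms of the even and odd parts and their inner product: the squared norm of [g] is
   [A + B + 2 * D] at [x] and [A + B - 2 * D] at [flip i x]. *)
set A := avg J0 (fun z => a z ^+ 2) x; set B := avg J0 (fun z => b z ^+ 2) x.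
set D := avg J0 (fun z => a z * b z) x.
have u1E : avg J0 (fun z => g z ^+ 2) x = A + B + 2 * D.
  rewrite /A /B /D -avgZ -!avgD; apply: eq_avg => z; rewrite /b; ring.
have u2E : avg J0 (fun z => g z ^+ 2) (flip i x) = A + B - 2 * D.
  rewrite avg_flip // /A /B /D -avgZ -avgD -avgB; apply: eq_avg => z.
  have -> : g (flip i z) = a z - b z
    by rewrite -[a z]aflip -[b z]opprK -bflip /b; ring.
  ring.
have AE : avg J0 (fun z => a z ^+ 2) (flip i x) = A.
  by rewrite avg_flip //; apply: eq_avg => z; rewrite aflip.
have A0 : 0 <= A by apply: avg_ge0 => z; apply: sqr_ge0.
have B0 : 0 <= B by apply: avg_ge0 => z; apply: sqr_ge0.
have CS : D ^+ 2 <= A * B by apply: avg_CauchySchwarz.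
have -> : avg J (fun z => g z ^+ 2) x = A + B by rewrite avgJ u1E u2E; field.
have u10 : 0 <= A + B + 2 * D by rewrite -u1E; apply: avg_ge0 => z;
  apply: sqr_ge0.
have u20 : 0 <= A + B - 2 * D by rewrite -u2E; apply: avg_ge0 => z;
  apply: sqr_ge0.
apply: le_trans (pow1D_two_point (u1 := A + B + 2 * D) (u2 := A + B - 2 * D)
  k0 ks s1 A0 B0 u10 u20 _ _); [|by ring|]; last first.
  have -> : (A + B + 2 * D - (A + B - 2 * D)) ^+ 2 = 16 * D ^+ 2 by ring.
  by rewrite ler_wpM2l.
have := IHn _ g x J0n; have := IHn _ g (flip i x) J0n.
have := IHn _ a x J0n; have := IHn _ a (flip i x) J0n.
rewrite u1E u2E AE -/A => h1 h2 h3 h4.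
apply: lerD; first by rewrite ler_wpM2l ?subr_ge0 //; lra.
by rewrite ler_wpM2l //; lra.
Qed.

End Hypercontractivity.

(** * Fourier coefficients of averages and derivatives *)

Section FourierOfAverages.
Set Implicit Arguments.
Unset Strict Implicit.
Variables (R : realFieldType) (I : finType).
Implicit Types (g h : cube I -> R) (S T L : {set I}) (x y : cube I) (i : I).

(** The odd part of [g] in coordinate [i], that is, the part of its expansion over the sets
    containing [i]; its squared norm is the influence of [i]. *)
Definition coord_deriv i g x : R := g x - avg [set i] g x.

Lemma unif_exp_chi S : unif_exp (chi R S) = (S == finset.set0)%:R :> R.
Proof.
have chi0 x : chi R (finset.set0 : {set I}) x = 1 by rewrite /chi big_set0.
have := sum_chi_cube R S finset.set0; under eq_bigr do rewrite chi0 mulr1.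
by rewrite /unif_exp => ->; rewrite mulrC mulKf ?card_cube_neq0.
Qed.

Lemma chi_mix S L x y : chi R S (mix L x y) = chi R (S :\: L) x * chi R (S :&:
  L) y.
Proof.
rewrite !chiE -big_split /=; apply: eq_bigr => i _.
rewrite /Defs.coord ffunE !inE.
by case: (i \in S); case: (i \in L); rewrite ?mul1r ?mulr1.
Qed.

Lemma avg_chi L S x : avg L (chi R S) x = (S :&: L == finset.set0)%:R * chi R S
  x.
Proof.
rewrite /avg (eq_unif_exp (chi_mix S L x)) unif_expZ unif_exp_chi mulrC.
case: eqP => [SL0|]; last by rewrite !mul0r.
by congr (_ * chi R _ x); rewrite -[RHS](finset.setID S L) SL0 finset.set0U.
Qed.

Lemma fourier_avg L g S :
  fourier (avg L g) S = (S :&: L == finset.set0)%:R * fourier g S.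
Proof.
symmetry; apply: (@fourier_unique R I (avg L g) (fun S =>
  (S :&: L == finset.set0)%:R * fourier g S)) => x.
rewrite (eq_avg L (fourier_expansion g)) /avg unif_exp_sum;
  apply: eq_bigr => T _.
by rewrite unif_expZ -/(avg L (chi R T) x) avg_chi mulrCA mulrA.
Qed.

Lemma fourier_deriv i g S : fourier (coord_deriv i g) S = (i \in S)%:R *
  fourier g S.
Proof.
have -> : fourier (coord_deriv i g) S = fourier g S - fourier (avg [set i] g) S.
  by rewrite /fourier -unif_expB; apply: eq_unif_exp => x; rewrite mulrBl.
rewrite fourier_avg.
have -> : (S :&: [set i] == finset.set0) = (i \notin S).
  by rewrite finset.setI_eq0 disjoint_sym disjoints1.
by case: (i \in S); rewrite /= ?mul1r ?mul0r ?subr0 ?subrr.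
Qed.

Lemma Parseval g : unif_exp (fun x => g x ^+ 2) = \sum_S fourier g S ^+ 2.
Proof.
transitivity (unif_exp (fun x => \sum_S fourier g S * (g x * chi R S x))).
  apply: eq_unif_exp => x; rewrite expr2 {1}(fourier_expansion g) mulr_suml.
  by apply: eq_bigr => S _; rewrite mulrAC mulrA.
by rewrite unif_exp_sum; apply: eq_bigr => S _; rewrite unif_expZ expr2.
Qed.

Lemma unif_exp_deriv_sqr i g :
  unif_exp (fun x => coord_deriv i g x ^+ 2) = influence g i.
Proof.
rewrite Parseval /influence big_mkcond [RHS]big_mkcond; apply: eq_bigr => S _.
by rewrite fourier_deriv; case: ifP; rewrite ?mul1r ?mul0r ?expr0n.
Qed.

Lemma bern_disjoint (s : R) S : bern s (fun L =>
  (S :&: L == finset.set0)%:R) = (1 - s) ^+ #|S|.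
Proof.
transitivity (\prod_(i : I) (s * (i \notin S)%:R + (1 - s) * 1)).
  rewrite -bern_prod; apply: eq_bern => L; rewrite finset.setI_eq0.
  case: (boolP [disjoint S & L]) => [dSL|].
    rewrite big1 // => i _; case: ifP => // iL.
    by rewrite (disjointFl dSL iL).
  case/pred0Pn => i /= /andP[iS iL].
  by rewrite (bigD1 i) //= iL iS mul0r.
rewrite (bigID (fun i => i \in S)) /= [X in _ * X]big1 => [|i ->];
  last by rewrite /=; ring.
rewrite [LHS]mulr1 -prodr_const; apply: eq_bigr => i ->; rewrite /=; ring.
Qed.

(** The right side is [s] times a geometric sum of [m] terms, each at least [(1 - s) ^+ m]. *)
Lemma natr_exp_le (s : R) m : 0 <= s -> s <= 1 -> m%:R * s * (1 - s) ^+ m <= 1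
  - (1 - s) ^+ m.
Proof.
move=> s0 s1; elim: m => [|m IHm]; first by rewrite !mul0r expr0 subrr.
have q0 : 0 <= (1 - s) ^+ m by rewrite exprn_ge0 ?subr_ge0.
have q1 : (1 - s) ^+ m <= 1 by rewrite exprn_ile1 ?subr_ge0 // gerBl.
rewrite exprS -natr1; move: IHm q0 q1; set q := (1 - s) ^+ m => IHm q0 q1; nra.
Qed.

(** A character survives averaging over [L] only if it avoids [L], so the sum equals that of
    [#|S| * (1 - s) ^+ #|S|] times the squared coefficients; the first two factors multiply to at
    most [1 / s]. *)
Lemma sum_bern_deriv_le (s : R) g : 0 < s -> s <= 1 ->
  \sum_i bern s (fun L => unif_exp (fun x => avg L (coord_deriv i g) x ^+ 2)) <=
  unif_exp (fun x => g x ^+ 2) / s.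
Proof.
move=> s0 s1.
have E i : bern s (fun L => unif_exp (fun x =>
  avg L (coord_deriv i g) x ^+ 2)) =
    \sum_(S : {set I}) (i \in S)%:R * ((1 - s) ^+ #|S| * fourier g S ^+ 2).
  transitivity (bern s (fun L => \sum_(S : {set I})
      ((i \in S)%:R * fourier g S ^+ 2) * (S :&: L == finset.set0)%:R)).
    apply: eq_bern => L; rewrite Parseval; apply: eq_bigr => S _.
    rewrite fourier_avg fourier_deriv.
    by case: eqP; case: (i \in S);
      rewrite /= ?(mul1r, mul0r, mulr1, mulr0) ?expr0n.
  rewrite bern_sum; apply: eq_bigr => S _.
  by rewrite bernZ bern_disjoint; ring.
under eq_bigr do rewrite E.
rewrite exchange_big Parseval mulr_suml /=; apply: ler_sum => S _.
rewrite -mulr_suml.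
have -> : \sum_i (i \in S)%:R = #|S|%:R :> R.
  by rewrite -sum1_card natr_sum [RHS]big_mkcond; apply: eq_bigr => i _;
    case: ifP.
rewrite mulrA [leRHS]mulrC ler_wpM2r ?sqr_ge0 // -div1r ler_pdivlMr // mulrAC.
apply: (le_trans (natr_exp_le #|S| (ltW s0) s1)).
by rewrite gerBl exprn_ge0 ?subr_ge0.
Qed.

Lemma influence_le_max_inf g i : influence g i <= max_inf g.
Proof. exact: le_bigmax. Qed.

End FourierOfAverages.

(** * Averaged derivatives are rarely large *)

Section SmallDerivatives.
Set Implicit Arguments.
Unset Strict Implicit.
Variables (R : realType) (I : finType).
Implicit Types (g h : cube I -> R) (S L : {set I}).

Lemma unif_exp_avg_sqr_le S g :
  unif_exp (fun x => avg S g x ^+ 2) <= unif_exp (fun x => g x ^+ 2).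
Proof.
by rewrite -[leRHS](unif_exp_avg S); apply: le_unif_exp => x; apply: avg_sqr.
Qed.

(** A union bound over [i] and Markov for the moment [2 + 2 * k], where [eta <= 1] gives [eta ^+ 4]
    as a lower bound for that power of [eta]. Averaging over [L1] keeps the sum of squared norms
    below [1 / s], and [L2] brings the hypercontractive gain. The sets [J i] are arbitrary because
    averaging over them only decreases the norm. *)
Lemma large_deriv_le (f : cube I -> R) (J : I -> {set I}) (s eta tau : R) :
  (forall x, 0 <= f x <= 1) -> max_inf f <= tau -> 0 < s -> s <= 1 ->
  0 < eta -> eta <= 1 ->
  bern s (fun L1 => bern s (fun L2 => unif_exp (fun x =>
    [exists i, eta < `|avg (J i :|: (L1 :|: L2)) (coord_deriv i f) x|]%:R))) <=
  tau `^ (s / 4) / (s * eta ^+ 4).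
Proof.
move=> f01 ftau s0 s1 e0 e1; set k := s / 4.
have k0 : 0 <= k by rewrite /k; lra.
have k4 : 4 * k <= s by rewrite /k; lra.
have e40 : 0 < eta ^+ 4 by rewrite exprn_gt0.
have s0' := ltW s0.
have phi_eta : eta ^+ 4 <= pow1D k (eta ^+ 2).
  have -> : eta ^+ 4 = eta ^+ 2 * (eta ^+ 2) `^ 1.
    by rewrite powRr1 ?sqr_ge0 // -exprD.
  rewrite /pow1D ler_wpM2l ?sqr_ge0 //.
  apply: ger_powR; last by rewrite /k; lra.
  by rewrite exprn_gt0 // exprn_ile1 // ltW.
pose w i L1 := unif_exp (fun x => avg L1 (coord_deriv i f) x ^+ 2).
have w0 i L1 : 0 <= w i L1 by apply: ge0_unif_exp => x; apply: sqr_ge0.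
have wtau i L1 : w i L1 <= tau.
  apply: (le_trans (unif_exp_avg_sqr_le _ _)); rewrite unif_exp_deriv_sqr.
  exact: le_trans (influence_le_max_inf _ _) ftau.
have tauk : 0 <= tau `^ k by apply: powR_ge0.
have step L1 :
  bern s (fun L2 => unif_exp (fun x =>
    [exists i, eta < `|avg (J i :|: (L1 :|: L2)) (coord_deriv i f) x|]%:R)) <=
  tau `^ k / eta ^+ 4 * \sum_i w i L1.
  apply: (@le_trans _ _ (bern s (fun L2 =>
    (eta ^+ 4)^-1 * \sum_i unif_exp (fun x =>
      pow1D k (avg (J i :|: (L1 :|: L2)) (coord_deriv i f) x ^+ 2))))).
    apply: le_bern => // L2; rewrite -unif_exp_sum -unif_expZ;
      apply: le_unif_exp => x.
    have sum0 i : 0 <= pow1D k (avg (J i :|: (L1 :|: L2)) (coord_deriv i f) x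
      ^+ 2).
      by rewrite pow1D_ge0 ?sqr_ge0.
    case: existsP => [[i hi]|_] /=;
      last by rewrite mulr_ge0 ?invr_ge0 ?(ltW e40) ?sumr_ge0.
    rewrite mulrC ler_pdivlMr // mul1r (bigD1 i) //= ler_wpDr ?sumr_ge0 //.
    apply: (le_trans phi_eta); apply: le_pow1D => //; first exact: sqr_ge0.
    by rewrite -[leRHS]real_normK ?num_real // ler_sqr ?nnegrE ?(ltW e0)
      ?normr_ge0 // ltW.
  rewrite bernZ bern_sum mulrAC mulrC ler_wpM2r ?invr_ge0 ?(ltW e40) //.
  rewrite mulr_sumr; apply: ler_sum => i _.
  pose h := avg (J i :|: L1) (coord_deriv i f).
  have hw : unif_exp (fun x => h x ^+ 2) <= w i L1.
    apply: le_trans (unif_exp_avg_sqr_le (J i) _).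
    by apply: le_unif_exp => x; rewrite avg_avg.
  have h0 : 0 <= unif_exp (fun x => h x ^+ 2).
    by apply: ge0_unif_exp => x; apply: sqr_ge0.
  (* The power [1 + k] is split: one factor stays as [w i L1], to be summed over [i], and the power
     [k] is bounded through [tau]. *)
  apply: (@le_trans _ _ (pow1D k (unif_exp (fun x => h x ^+ 2)))); last first.
    rewrite /pow1D mulrC ler_pM ?powR_ge0 //.
    apply: ge0_ler_powR; rewrite ?nnegrE ?(le_trans h0 hw) ?(le_trans hw) //.
    exact: le_trans (w0 i L1) (wtau i L1).
  have x0 : cube I := [ffun=> false].
  have := bern_avg_hypercontractive finset.setT h x0 k0 k4 s1; rewrite avg_setT.
  apply: le_trans; rewrite le_eqVlt; apply/orP; left; apply/eqP.
  apply: eq_bern => L2; rewrite avg_setT finset.setIT; apply: eq_unif_exp => x.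
  by rewrite /h avg_avg finset.setUA finset.setUC.
apply: (le_trans (le_bern s0' s1 step)); rewrite bernZ bern_sum.
have := sum_bern_deriv_le f s0 s1; rewrite -/(w _ _) => hsum.
have f1 : unif_exp (fun x => f x ^+ 2) <= 1.
  rewrite -[leRHS](unif_exp_cst _ (card_cube_gt0 I)); apply: le_unif_exp => x.
  by case/andP: (f01 x) => *; rewrite exprn_ile1.
have -> : tau `^ k / (s * eta ^+ 4) = tau `^ k / eta ^+ 4 * s^-1.
  by field; rewrite !gt_eqF.
rewrite ler_wpM2l ?divr_ge0 ?(ltW e40) //.
apply: (le_trans hsum); rewrite -[leRHS]mul1r ler_wpM2r // invr_ge0 ltW //.
Qed.

End SmallDerivatives.

(** * Elementary inequalities for one tilted coordinate *)

Section TiltedExposure.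
Set Implicit Arguments.
Unset Strict Implicit.
Variable R : realType.

Lemma Bernoulli_inequality (x : R) m : - 1 <= x -> 1 + m%:R * x <= (1 + x) ^+ m.
Proof.
move=> x1; elim: m => [|m IHm]; first by rewrite mul0r expr0 addr0.
have h : 0 <= m%:R * x ^+ 2 by rewrite mulr_ge0 ?sqr_ge0.
rewrite exprS; have h1 : (1 + x) * (1 + m%:R * x) <= (1 + x) * (1 + x) ^+ m.
  by rewrite ler_wpM2l //; lra.
by apply: le_trans h1; rewrite -natr1; nra.
Qed.

(** The one-step supermartingale inequality. With [1 + u = p ^+ 2] and [1 - u = q ^+ 2] the sum
    splits into [p + q], which concavity of the root keeps below [2 - u ^+ 2 / 4], a cross term that
    is never positive, and a quadratic term of at most [u ^+ 2 / 4]. *)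
Lemma inv_sqrt_two_point (u c a : R) :
  `|u| <= 1 / 2 -> 0 <= c -> 0 <= a -> a <= 1 / 12 ->
  (1 + (1 + c) * u + a * u ^+ 2) / Num.sqrt (1 + u)
  + (1 - (1 + c) * u + a * u ^+ 2) / Num.sqrt (1 - u) <= 2.
Proof.
rewrite ler_norml => /andP[u1 u2] c0 a0 a1.
set p := Num.sqrt (1 + u); set q := Num.sqrt (1 - u).
have p2 : p ^+ 2 = 1 + u by rewrite sqr_sqrtr //; lra.
have q2 : q ^+ 2 = 1 - u by rewrite sqr_sqrtr //; lra.
have p0 : 0 <= p by apply: sqrtr_ge0.
have q0 : 0 <= q by apply: sqrtr_ge0.
have pl : 2 / 3 <= p by nra.
have ql : 2 / 3 <= q by nra.
have pn0 : p != 0 by rewrite gt_eqF //; lra.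
have qn0 : q != 0 by rewrite gt_eqF //; lra.
have -> : (1 + (1 + c) * u + a * u ^+ 2) / p + (1 - (1 + c) * u + a * u ^+ 2) /
  q
   = p + q + c * (u * (q - p) / (p * q)) + a * u ^+ 2 * (p^-1 + q^-1).
  have -> : 1 + (1 + c) * u + a * u ^+ 2 = p ^+ 2 + c * u + a * u ^+ 2
    by rewrite p2; ring.
  have -> : 1 - (1 + c) * u + a * u ^+ 2 = q ^+ 2 - c * u + a * u ^+ 2
    by rewrite q2; ring.
  by field; rewrite ?pn0 ?qn0.
have pV : p^-1 <= 3 / 2.
  by rewrite -[leRHS]invrK lef_pV2 ?posrE ?invr_gt0; lra.
have qV : q^-1 <= 3 / 2.
  by rewrite -[leRHS]invrK lef_pV2 ?posrE ?invr_gt0; lra.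
have pq : p + q <= 2 - u ^+ 2 / 4.
  have pq2 : (p * q) ^+ 2 = 1 - u ^+ 2 by rewrite exprMn p2 q2; ring.
  have pql : p * q <= 1 - u ^+ 2 / 2.
    have : 0 <= p * q by rewrite mulr_ge0.
    by have : 0 <= u ^+ 2 := sqr_ge0 u; move: pq2; set v := u ^+ 2; nra.
  have : (p + q) ^+ 2 <= 4 - u ^+ 2 by rewrite sqrrD p2 q2; lra.
  have : u ^+ 2 <= 1 / 4 by nra.
  by have : 0 <= u ^+ 2 := sqr_ge0 u; set v := u ^+ 2; nra.
have cross : c * (u * (q - p) / (p * q)) <= 0.
  have pqV : 0 <= (p * q)^-1 by rewrite invr_ge0 mulr_ge0.
  have uqp : u * (q - p) <= 0.
    have E : (q - p) * (q + p) = - (2 * u) by rewrite -subr_sqr p2 q2; ring.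
    by move: E pl ql; nra.
  by rewrite mulr_ge0_le0 // mulr_le0_ge0.
have quad : a * u ^+ 2 * (p^-1 + q^-1) <= u ^+ 2 / 4.
  have : a * (p^-1 + q^-1) <= 1 / 4.
    have : 0 <= p^-1 by rewrite invr_ge0.
    have : 0 <= q^-1 by rewrite invr_ge0.
    by move: pV qV; set v := p^-1; set w := q^-1; nra.
  have := sqr_ge0 u; set v := u ^+ 2; set w := p^-1 + q^-1; nra.
lra.
Qed.

End TiltedExposure.

(** * The stopped exposure martingale and the player's likelihood *)

Section StoppedExposure.
Set Implicit Arguments.
Unset Strict Implicit.
Variables (R : realType) (n : nat) (f : cube 'I_n -> R) (L : {set 'I_n}).
Variables (r delta eta : R).
Hypotheses (f01 : forall x, 0 <= f x <= 1) (r0 : 0 < r) (r1 : r <= 1).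
Hypotheses (d0 : 0 < delta) (er : eta <= r * delta / 2).
Let mu := unif_exp f.
Hypothesis mu0 : 0 < mu.
Implicit Types (x : cube 'I_n) (t : nat) (i : 'I_n) (e : {set 'I_n}).

Definition later t : {set 'I_n} := [set j : 'I_n | (t <= j)%N].

(** The Doob martingale of [f]: at time [t] the coordinates outside [L] with index below [t] are
    known. *)
Definition exposed t : cube 'I_n -> R := avg (L :|: later t) f.

(** Two conditions for taking a step: the current mean is at least [delta], and the step about to be
    made is at most [eta]. The second looks ahead, but only at the size of the increment. *)
Fixpoint going t x : bool :=
  if t is t'.+1 then
    [&& going t' x, delta <= exposed t' x & `|exposed t'.+1 x - exposed t' x|
      <= eta]
  else true.

Fixpoint stopped t x : R :=
  if t is t'.+1 then (if going t x then exposed t x else stopped t' x)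
  else unif_exp f.

Definition rel_incr t x : R := (stopped t.+1 x - stopped t x) / stopped t x.

Lemma exposed0 x : exposed 0 x = unif_exp f.
Proof.
rewrite /exposed; have -> : L :|: later 0 = [set: 'I_n].
  by apply/finset.setP => j; rewrite !inE orbT.
exact: avg_setT.
Qed.

Lemma exposedn x : exposed n x = avg L f x.
Proof.
rewrite /exposed; congr (avg _ f x); apply/finset.setP => j; rewrite !inE.
by rewrite leqNgt ltn_ord orbF.
Qed.

Lemma going_stopped t x : going t x -> stopped t x = exposed t x.
Proof. by case: t => [_|t /= ->] //; rewrite exposed0. Qed.

Lemma stoppedS t x :
  stopped t.+1 x = stopped t x + (going t.+1 x)%:R * (exposed t.+1 x - exposed
    t x).
Proof.
rewrite /=; case: ifP => [|_]; last by rewrite mul0r addr0.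
by case/and3P => g _ _; rewrite (going_stopped g) mul1r addrC subrK.
Qed.

(** A step is taken only from a mean of at least [delta] and moves it by at most
    [eta <= delta / 2]. *)
Lemma stopped_gt0 t x : 0 < stopped t x.
Proof.
elim: t => [|t IHt] //=; case: ifP => //; case/and3P => g dX.
rewrite ler_norml => /andP[h _].
have : r * delta <= delta by rewrite ler_piMl // ltW.
by move: d0 er; lra.
Qed.

Lemma stopped_le1 t x : stopped t x <= 1.
Proof.
have f1 z : f z <= 1 by case/andP: (f01 z).
elim: t => [|t IHt] /=.
  by rewrite -(avg_setT f x); apply: avg_le1.
by case: ifP => // _; apply: avg_le1.
Qed.

(** Hence [r^-1 * rel_incr] has absolute value at most [1 / 2] and is a legitimate bias for the
    player. *)
Lemma rel_incr_bound t x : `|rel_incr t x| <= r / 2.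
Proof.
rewrite /rel_incr normrM normfV [`|stopped t x|]gtr0_norm ?stopped_gt0 //.
rewrite ler_pdivrMr ?stopped_gt0 // stoppedS addrC addKr.
have s0 := stopped_gt0 t x.
case: (boolP (going t.+1 x)) => /=;
  last by rewrite mul0r normr0 mulr_ge0 ?(ltW s0) ?divr_ge0 ?(ltW r0).
case/and3P => g dX h; rewrite mul1r (going_stopped g); apply: (le_trans h).
apply: (le_trans er); by rewrite mulrAC ler_wpM2l // divr_ge0 // ltW.
Qed.

Lemma laterS i : later i = i |: later i.+1.
Proof.
by apply/finset.setP => j; rewrite !inE leq_eqVlt eq_sym.
Qed.

Lemma later_sub t t' : (t <= t')%N -> later t' \subset later t.
Proof. by move=> tt'; apply/fintype.subsetP => j; rewrite !inE;
  apply: leq_trans. Qed.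

Lemma indep_exposed t : indep (later t) (exposed t).
Proof. by apply: indep_avg; apply: finset.subsetUr. Qed.

Lemma indep_going t : indep (later t) (going t).
Proof.
elim: t => [|t IHt] //= x y.
have sub := later_sub (leqnSn t).
by rewrite (indep_sub sub IHt) (indep_sub sub (indep_exposed t)) indep_exposed.
Qed.

Lemma indep_stopped t : indep (later t) (stopped t).
Proof.
elim: t => [|t IHt] // x y.
have sub := later_sub (leqnSn t).
rewrite [LHS]/= [RHS]/= -/(going t.+1 _) -/(going t.+1 x) (indep_sub sub IHt).
by have := indep_going t.+1 x y; rewrite /= => ->;
  have := indep_exposed t.+1 x y => ->.
Qed.

Lemma set1_later i t : (t <= i)%N -> [set i] \subset later t.
Proof. by move=> ti; rewrite finset.sub1set inE. Qed.

Lemma exposed_avg i x : exposed i x = avg [set i] (exposed i.+1) x.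
Proof. by rewrite /exposed avg_avg finset.setUCA -laterS. Qed.

Lemma exposed_flip i x : exposed i.+1 (flip i x) = 2 * exposed i x - exposed
  i.+1 x.
Proof. by rewrite exposed_avg avg1E; field. Qed.

Lemma exposed_flip_lt i t x : (t <= i)%N -> exposed t (flip i x) = exposed t x.
Proof.
move=> ti; apply: (proj2 (indep1_flip i (exposed t))).
exact: indep_sub (set1_later ti) (indep_exposed t).
Qed.

(** Flipping the coordinate about to be exposed reverses the increment and keeps its size, so the
    stopping rule is predictable. *)
Lemma going_flip i x : going i.+1 (flip i x) = going i.+1 x.
Proof.
rewrite /= (exposed_flip_lt _ (leqnn i)) exposed_flip.
rewrite (proj2 (indep1_flip i (going i)) (indep_sub (set1_later (leqnn i))
  (indep_going i))).
by rewrite -[in LHS]normrN; congr [&& _, _ & `|_| <= _]; ring.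
Qed.

Lemma stopped_flip_lt i t x : (t <= i)%N -> stopped t (flip i x) = stopped t x.
Proof.
move=> ti; apply: (proj2 (indep1_flip i (stopped t))).
exact: indep_sub (set1_later ti) (indep_stopped t).
Qed.

Lemma stopped_flip i x : stopped i.+1 (flip i x) = 2 * stopped i x - stopped
  i.+1 x.
Proof.
rewrite !stoppedS going_flip exposed_flip (stopped_flip_lt _ (leqnn i)).
by rewrite (exposed_flip_lt _ (leqnn i)); ring.
Qed.

Lemma rel_incr_flip i x : rel_incr i (flip i x) = - rel_incr i x.
Proof.
rewrite /rel_incr stopped_flip (stopped_flip_lt _ (leqnn i)) -mulNr.
by congr (_ / _); ring.
Qed.

Lemma rel_incr_flip_lt i t x : (t < i)%N -> rel_incr t (flip i x) = rel_incr t
  x.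
Proof. by move=> ti; rewrite /rel_incr !stopped_flip_lt // ltnW. Qed.

Lemma stopped_rel_incr t x : stopped t.+1 x = stopped t x * (1 + rel_incr t x).
Proof. by rewrite /rel_incr; field; rewrite gt_eqF ?stopped_gt0. Qed.

Lemma prod_rel_incr t x : \prod_(i < t) (1 + rel_incr i x) = stopped t x / mu.
Proof.
elim: t => [|t IHt]; first by rewrite big_ord0 /= divff // gt_eqF.
by rewrite big_ord_recr /= IHt -/(stopped t.+1 x) stopped_rel_incr mulrAC.
Qed.

(* The density, with respect to the uniform law, of the choices of a player who
   controls the coordinates of [e]. Averaged over [e] of density [r], the case
   [c = 1 / r] has density [stopped / mu] (bern_likelihood). *)
Definition likelihood c e t x : R :=
  \prod_(i : 'I_n | (i < t)%N) (if i \in e then 1 + c * rel_incr i x else 1).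

Lemma likelihoodS c e i x : likelihood c e i.+1 x =
  likelihood c e i x * (if i \in e then 1 + c * rel_incr i x else 1).
Proof.
rewrite /likelihood (bigD1 i) //= mulrC; congr (_ * _); apply: eq_bigl => j.
by rewrite ltnS [RHS]ltn_neqAle andbC.
Qed.

Lemma likelihood_flip c e i x : likelihood c e i (flip i x) = likelihood c e i
  x.
Proof. by apply: eq_bigr => j ji; rewrite rel_incr_flip_lt. Qed.

(** Peel off the last coordinate: if it lies in [e], flipping it negates its own [rel_incr] and
    leaves the earlier factors alone, so its factor averages to 1. *)
Lemma avg_likelihood c e t x : (t <= n)%N -> avg e (likelihood c e t) x = 1.
Proof.
elim: t => [|t IHt] tn.
  rewrite -[RHS](avg_cst e 1 x); apply: eq_avg => z.
  by rewrite /likelihood big_pred0.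
pose i := Ordinal tn; rewrite -[RHS](IHt (ltnW tn)) -[t]/(val i).
case: (boolP (i \in e)) => ie; last first.
  by apply: eq_avg => z; rewrite likelihoodS (negPf ie) mulr1.
have eE : e = e :|: [set i] by rewrite finset.setUC;
  apply/esym/finset.setUidPr; rewrite finset.sub1set.
rewrite {1}eE -avg_avg; apply: eq_avg => z.
by rewrite avg1E !likelihoodS ie likelihood_flip rel_incr_flip; field.
Qed.

Lemma likelihood_ge0 c e t x : 0 <= c -> c <= r^-1 -> 0 <= likelihood c e t x.
Proof.
move=> c0 cr; apply: prodr_ge0 => i _; case: ifP => // _.
have := rel_incr_bound i x; rewrite ler_norml => /andP[h _].
have : c * (r / 2) <= 1 / 2.
  by rewrite mulrA ler_pM2r ?invr_gt0 // -ler_pdivlMr // mul1r.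
have : c * (- (r / 2)) <= c * rel_incr i x by rewrite ler_wpM2l.
lra.
Qed.

(** Bernoulli's inequality in each factor. An [N]-th root of the likelihood is thus bounded by a
    likelihood with [1 / N] of the bias, whose product with the original has a computable mean over
    [e]. *)
Lemma likelihood_expn (N : nat) e t x : (0 < N)%N ->
  likelihood r^-1 e t x <= likelihood (r^-1 / N%:R) e t x ^+ N.
Proof.
move=> N0; rewrite /likelihood -prodrXl; apply: ler_prod => i _.
case: ifP => _; last by rewrite expr1n ler01 lexx.
have rV : 0 < r^-1 by rewrite invr_gt0.
have h : `|r^-1 * rel_incr i x| <= 1 / 2.
  rewrite normrM gtr0_norm // mulrC ler_pdivrMr //.
  by apply: le_trans (rel_incr_bound i x) _; lra.
move: h; rewrite ler_norml => /andP[h1 h2]; set y := r^-1 * _ in h1 h2 *.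
have N1 : 1 <= N%:R :> R by rewrite ler1n.
have Nn0 : N%:R != 0 :> R by rewrite gt_eqF // ltr0n.
apply/andP; split; first by lra.
have -> : r^-1 / N%:R * rel_incr i x = y / N%:R by rewrite /y mulrAC.
have {1}-> : y = N%:R * (y / N%:R) by field.
apply: Bernoulli_inequality.
rewrite ler_pdivlMr ?ltr0n //; lra.
Qed.

Lemma bern_likelihood x : bern r (fun e =>
  likelihood r^-1 e n x) = stopped n x / mu.
Proof.
rewrite -prod_rel_incr;
  transitivity (\prod_(i < n) (r * (1 + r^-1 * rel_incr i x) + (1 - r) * 1)).
  rewrite -bern_prod; apply: eq_bern => e.
  by apply: eq_bigl => i; rewrite ltn_ord.
by apply: eq_bigr => i _; field; rewrite gt_eqF.
Qed.

(** For [c = 1 / N] and [a = 1 / (r * N)] the numerator is the mean over [e] of the product of the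
    likelihoods with biases [u / r] and [u / (r * N)], where [u] is [rel_incr]. *)
Let potential c a t x : R :=
  \prod_(i < n | (i < t)%N) (1 + (1 + c) * rel_incr i x + a * rel_incr i x ^+ 2)
  / Num.sqrt (stopped t x).

(** Going back one step, [x] is paired with [flip i x], which negates only the last [rel_incr];
    [inv_sqrt_two_point] bounds the pair. *)
Lemma unif_exp_potential c a t :
  0 <= c -> c <= 1 -> 0 <= a -> a <= 1 / 12 -> (t <= n)%N ->
  unif_exp (potential c a t) <= (Num.sqrt mu)^-1.
Proof.
move=> c0 c1 a0 a1; elim: t => [|t IHt] tn.
  rewrite le_eqVlt; apply/orP; left; apply/eqP.
  rewrite -[RHS](unif_exp_cst _ (card_cube_gt0 'I_n)); apply: eq_unif_exp => x.
  by rewrite /potential big_pred0 // div1r.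
pose i := Ordinal tn; apply: le_trans (IHt (ltnW tn)); rewrite -[t]/(val i).
rewrite -(unif_exp_avg [set i]); apply: le_unif_exp => x; rewrite avg1E.
pose F j y := 1 + (1 + c) * rel_incr j y + a * rel_incr j y ^+ 2.
have potS y : potential c a i.+1 y =
    (\prod_(j < n | (j < i)%N) F j y) * F i y / Num.sqrt (stopped i.+1 y).
  rewrite /potential (bigD1 i) //= (mulrC (\prod_(j < n | _) _) (F i y)).
  congr (_ * _ / _); apply: eq_bigl => j.
  by rewrite ltnS [RHS]ltn_neqAle andbC.
have PE : \prod_(j < n | (j < i)%N) F j (flip i x) = \prod_(j < n | (j < i)%N)
  F j x.
  by apply: eq_bigr => j ji; rewrite /F rel_incr_flip_lt.
rewrite !potS PE !stopped_rel_incr (stopped_flip_lt _ (leqnn i)).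
rewrite /F rel_incr_flip sqrrN mulrN /potential -/(F _ _).
have u1 : `|rel_incr i x| <= 1 / 2.
  apply: le_trans (rel_incr_bound i x) _; move: r1; lra.
have P0 : 0 <= \prod_(j < n | (j < i)%N) F j x.
  apply: prodr_ge0 => j _; rewrite /F.
  have := rel_incr_bound j x; rewrite ler_norml => /andP[h _].
  have h2 : 0 <= a * rel_incr j x ^+ 2 by rewrite mulr_ge0 ?sqr_ge0.
  have h3 : (1 + c) * (- (1 / 2)) <= (1 + c) * rel_incr j x.
    by rewrite ler_wpM2l; move: r1 h; lra.
  lra.
rewrite ![Num.sqrt (stopped i x * _)]sqrtrM ?(ltW (stopped_gt0 _ _)) //.
have := inv_sqrt_two_point u1 c0 a0 a1.
set P := \prod_(j < n | _) _ in P0 *; set u := rel_incr i x.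
set W := Num.sqrt (stopped i x).
have W0 : 0 <= P / W by rewrite divr_ge0 // sqrtr_ge0.
set p := Num.sqrt (1 + u); set q := Num.sqrt (1 - u) => h.
have := ler_wpM2l W0 h; rewrite mulrDr !invfM => {}h.
have -> : P = \prod_(j < n | (j < i)%N) (1 + (1 + c) * rel_incr j x + a *
  rel_incr j x ^+ 2) by [].
move: h; rewrite -/P; set A := 1 + (1 + c) * u + _;
  set B := 1 - (1 + c) * u + _.
set W' := W^-1; set p' := p^-1; set q' := q^-1; rewrite -[F i x]/A; lra.
Qed.

(** Markov's inequality under the player's law: where the likelihood exceeds [S ^+ N], the one with
    bias divided by [N] is at least [S]. The mean of their product is at most the potential because
    [stopped] is at most 1; [12 <= r * N] gives [a <= 1 / 12]. *)
Lemma likelihood_tail (N : nat) (S : R) : (0 < N)%N -> 12 <= r * N%:R -> 0 < S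
  ->
  unif_exp (fun x => bern r (fun e =>
    likelihood r^-1 e n x * (S ^+ N < likelihood r^-1 e n x)%R%:R)) <=
  (S * Num.sqrt mu)^-1.
Proof.
move=> N0 rN S0; pose c := N%:R^-1 : R; pose a := (r * N%:R)^-1.
have N1 : 1 <= N%:R :> R by rewrite ler1n.
have c0 : 0 <= c by rewrite invr_ge0.
have c1 : c <= 1 by rewrite invf_le1 // (lt_le_trans ltr01).
have rV : 0 <= r^-1 by rewrite invr_ge0 ltW.
have a0 : 0 <= a by rewrite invr_ge0 mulr_ge0 // ltW.
have a1 : a <= 1 / 12.
  by rewrite div1r lef_pV2 // posrE ?mulr_gt0 // (lt_le_trans ltr01).
have cr : r^-1 / N%:R <= r^-1 by rewrite ler_piMr.
rewrite invfM -(ler_pM2l S0) mulVKf ?gt_eqF //.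
apply: le_trans (unif_exp_potential c0 c1 a0 a1 (leqnn n)).
rewrite -unif_expZ; apply: le_unif_exp => x.
pose lik1 e := likelihood r^-1 e n x;
  pose lik2 e := likelihood (r^-1 / N%:R) e n x.
apply: (@le_trans _ _ (bern r (fun e => lik1 e * lik2 e))).
  rewrite -bernZ; apply: le_bern => // [|e]; first exact: ltW.
  have l1 : 0 <= lik1 e by apply: likelihood_ge0.
  have l2 : 0 <= lik2 e by apply: likelihood_ge0 => //; rewrite divr_ge0.
  rewrite mulrCA -/(lik1 e) ler_wpM2l //.
  case: ltP => h; last by rewrite mulr0.
  rewrite mulr1 leNgt; apply/negP => lS.
  have : lik2 e ^+ N < S ^+ N by rewrite ltr_pXn2r // nnegrE ltW.
  by move=> /(le_lt_trans (likelihood_expn e n x N0)); rewrite ltNge (ltW h).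
have -> : bern r (fun e => lik1 e * lik2 e) =
    \prod_(i < n) (1 + (1 + c) * rel_incr i x + a * rel_incr i x ^+ 2).
  transitivity (\prod_(i < n)
    (r * ((1 + r^-1 * rel_incr i x) * (1 + r^-1 / N%:R * rel_incr i x)) + (1 -
      r) * 1)).
    rewrite -bern_prod; apply: eq_bern => e;
      rewrite /lik1 /lik2 /likelihood -big_split /=.
    rewrite big_mkcond; apply: eq_bigr => i _; rewrite ltn_ord.
    by case: ifP; rewrite ?mulr1.
  apply: eq_bigr => i _; rewrite /c /a; field.
  by rewrite !gt_eqF // ltr0n.
have W0 := stopped_gt0 n x.
have sW0 : 0 < Num.sqrt (stopped n x) by rewrite sqrtr_gt0.
rewrite /potential; under [in leRHS]eq_bigl do rewrite ltn_ord.
rewrite ler_pdivlMr // ler_piMr //; last first.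
  by rewrite -sqrtr1 ler_wsqrtr // stopped_le1.
apply: prodr_ge0 => i _.
have := rel_incr_bound i x; rewrite ler_norml => /andP[h _].
have h2 : 0 <= a * rel_incr i x ^+ 2 by rewrite mulr_ge0 ?sqr_ge0.
have h3 : (1 + c) * (- (1 / 2)) <= (1 + c) * rel_incr i x.
  by rewrite ler_wpM2l; move: r1 h; lra.
lra.
Qed.

Lemma stopped_cases t x : (t <= n)%N ->
  [|| going t x, stopped t x < delta |
      [exists i : 'I_n, eta < `|exposed i.+1 x - exposed i x|]].
Proof.
elim: t => [|t IHt] // tn; rewrite [going t.+1 x]/= [stopped t.+1 x]/=.
have := IHt (ltnW tn); case: (boolP (going t x)) => g /=; last by [].
move=> _; rewrite (going_stopped g).
case: (leP delta (exposed t x)) => dX /=; last by rewrite dX.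
case: (leP `|exposed t.+1 x - exposed t x| eta) => [//|h] /=; apply/orP;
  right; apply/existsP.
by exists (Ordinal tn).
Qed.

(** Averaged over [e] the likelihood is [stopped / mu]. If no increment is large, a final mean below
    [delta] means that [stopped] is itself below [delta]; otherwise [stopped <= 1] suffices. *)
Lemma likelihood_small_exposed :
  unif_exp (fun x => bern r (fun e =>
    likelihood r^-1 e n x * (exposed n x < delta)%R%:R)) <=
  (delta + unif_exp (fun x =>
     [exists i : 'I_n, eta < `|exposed i.+1 x - exposed i x|]%:R)) / mu.
Proof.
rewrite -[delta in leRHS](unif_exp_cst _ (card_cube_gt0 'I_n)) -unif_expD mulrC
  -unif_expZ.
apply: le_unif_exp => x.
under eq_bern do rewrite mulrC.
rewrite bernZ bern_likelihood mulrA [leLHS]mulrC ler_wpM2l ?invr_ge0 ?(ltW mu0)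
  //.
have := stopped_cases x (leqnn n).
have W0 := ltW (stopped_gt0 n x); have W1 := stopped_le1 n x.
case: existsP => _ /=.
  by move=> _; rewrite ler_wpDl ?(ltW d0) //; case: ltP => _;
    rewrite ?mul1r ?mul0r.
rewrite orbF addr0; case: (ltP (exposed n x)) => [h|_ _];
  last by rewrite mul0r ltW.
by case/orP => [/going_stopped ->|h']; rewrite mul1r ltW.
Qed.

(** Brings the increments into the form of [large_deriv_le], with [later i.+1] as [J i]. *)
Lemma exposed_incr i x :
  exposed i.+1 x - exposed i x = avg (later i.+1 :|: L) (coord_deriv i f) x.
Proof.
rewrite exposed_avg /exposed (finset.setUC (later _)) /coord_deriv.
rewrite (avgB _ f (avg [set i] f)) !avg_avg; congr (_ - avg _ f x).
exact: finset.setUC.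
Qed.

(** Over the coordinates of [e] the likelihood has mean 1. If [f] has mean at most [eps] there, the
    points with [exposed] at least [delta] and likelihood at most [S ^+ N] carry at most half of
    this mass. The bad points carry the rest, whence the factor 2. *)
Lemma bern_small_avg (N : nat) (S eps : R) :
  (0 < N)%N -> 12 <= r * N%:R -> 0 < S -> 2 * S ^+ N * eps <= delta ->
  bern r (fun e => unif_exp (fun x => (avg (L :|: e) f x <= eps)%R%:R)) <=
  2 * ((delta + unif_exp (fun x =>
         [exists i : 'I_n, eta < `|exposed i.+1 x - exposed i x|]%:R)) / mu
       + (S * Num.sqrt mu)^-1).
Proof.
move=> N0 rN S0 Se.
have rV : 0 <= r^-1 by rewrite invr_ge0 ltW.
have T0 : 0 < S ^+ N by rewrite exprn_gt0.
apply: (@le_trans _ _ (2 * (unif_exp (fun x => bern r (fun e =>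
    likelihood r^-1 e n x * (exposed n x < delta)%R%:R)) +
  unif_exp (fun x => bern r (fun e =>
    likelihood r^-1 e n x * (S ^+ N < likelihood r^-1 e n x)%R%:R)))));
      last first.
  by rewrite ler_wpM2l // lerD ?likelihood_small_exposed ?likelihood_tail.
rewrite !unif_exp_bern -bernD -bernZ; apply: le_bern => // [|e];
  first exact: ltW.
rewrite -unif_expD -unif_expZ.
pose lik := likelihood r^-1 e n.
have lik0 x : 0 <= lik x by apply: likelihood_ge0.
pose bad x := lik x * (exposed n x < delta)%R%:R + lik x * (S ^+ N < lik
  x)%R%:R.
have bad0 x : 0 <= bad x by rewrite addr_ge0 ?mulr_ge0 ?ler0n.
rewrite -[leRHS](unif_exp_avg e); apply: le_unif_exp => x.
rewrite (avgZ e 2 bad).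
case: (leP (avg (L :|: e) f x) eps) => small; last by apply: mulr_ge0 => //;
  apply: avg_ge0.
have X0 z : 0 <= exposed n z by apply: avg_ge0 => y; case/andP: (f01 y).
(* Away from the bad events [exposed n z / delta] is at least 1, so it can multiply the bound
   [S ^+ N] on the likelihood. *)
have pw z : lik z <= S ^+ N / delta * exposed n z + bad z.
  have A0 : 0 <= S ^+ N / delta * exposed n z.
    by rewrite mulr_ge0 // divr_ge0 // ltW.
  have l0 := lik0 z; rewrite /bad.
  case: (ltP (exposed n z)) => hX; case: (ltP (S ^+ N)) => hl /=; try by lra.
  rewrite !mulr0 !addr0; apply: (le_trans hl).
  by rewrite -mulrA ler_pMr // ler_pdivlMl // mulr1.
have := le_avg e x pw; rewrite (avg_likelihood _ _ _ (leqnn n)) avgD avgZ.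
have -> : avg e (exposed n) x = avg (L :|: e) f x.
  by rewrite finset.setUC -avg_avg; apply: eq_avg => z; rewrite exposedn.
have : S ^+ N / delta * avg (L :|: e) f x <= 1 / 2.
  apply: (@le_trans _ _ (S ^+ N / delta * eps)).
    by rewrite ler_wpM2l // divr_ge0 // ltW.
  by rewrite mulrAC ler_pdivrMr //; lra.
by rewrite -/lik mulr1n; set A := S ^+ N / delta * _; set B := avg e bad x; lra.
Qed.

End StoppedExposure.

(** * Small means for random alive sets *)

Section SmallRestrictedMeans.
Set Implicit Arguments.
Unset Strict Implicit.
Variable R : realType.

(** The hidden set is [L1 :|: L2], whose two halves make the increments small through
    [large_deriv_le]; [e] is the player's set, of the same density [s]. *)
Lemma bern3_small_avg n (f : cube 'I_n -> R) (tau s delta eta S eps : R) (N :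
  nat) :
  (forall x, 0 <= f x <= 1) -> 0 < unif_exp f -> max_inf f <= tau ->
  0 < s -> s <= 1 -> 0 < delta -> 0 < eta -> eta <= 1 -> eta <= s * delta / 2 ->
  (0 < N)%N -> 12 <= s * N%:R -> 0 < S -> 2 * S ^+ N * eps <= delta ->
  bern s (fun L1 => bern s (fun L2 => bern s (fun e =>
    unif_exp (fun x => (avg (L1 :|: L2 :|: e) f x <= eps)%R%:R)))) <=
  2 * ((delta + tau `^ (s / 4) / (s * eta ^+ 4)) / unif_exp f
       + (S * Num.sqrt (unif_exp f))^-1).
Proof.
move=> f01 mu0 ftau s0 s1 d0 e0 e1 er N0 sN S0 Se.
have s0' := ltW s0; set mu := unif_exp f; set K := (S * Num.sqrt mu)^-1.
pose D L x := [exists i : 'I_n, eta < `|avg (later n i.+1 :|: L) (coord_deriv i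
  f) x|].
apply: (@le_trans _ _ (bern s (fun L1 => bern s (fun L2 =>
    2 * ((delta + unif_exp (fun x => (D (L1 :|: L2) x)%:R)) / mu + K))))).
  apply: le_bern => // L1; apply: le_bern => // L2.
  have := bern_small_avg (L1 :|: L2) f01 s0 s1 d0 er mu0 N0 sN S0 Se.
  move/le_trans; apply; rewrite le_eqVlt; apply/orP; left; apply/eqP.
  congr (2 * ((_ + _) / _ + _)); apply: eq_unif_exp => x.
  by congr (nat_of_bool _)%:R; apply: eq_existsb => i; rewrite exposed_incr.
have -> : (fun L1 => bern s (fun L2 =>
    2 * ((delta + unif_exp (fun x => (D (L1 :|: L2) x)%:R)) / mu + K))) =
  (fun L1 => 2 * (mu^-1 * delta + K)
    + (2 * mu^-1) * bern s (fun L2 => unif_exp (fun x =>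
      (D (L1 :|: L2) x)%:R))).
  apply/funext => L1; rewrite -[X in X + _](@bern_cst R 'I_n s) -bernZ -bernD.
  by apply: eq_bern => L2; ring.
rewrite bernD bern_cst bernZ.
have -> : 2 * ((delta + tau `^ (s / 4) / (s * eta ^+ 4)) / mu + K) =
  2 * (mu^-1 * delta + K) + 2 * mu^-1 * (tau `^ (s / 4) / (s * eta ^+ 4))
    by ring.
rewrite lerD2l ler_wpM2l ?mulr_ge0 ?invr_ge0 ?(ltW mu0) //.
exact: (large_deriv_le (fun i : 'I_n => later n i.+1) f01 ftau s0 s1 e0 e1).
Qed.

(** Averaging over the rest of [B] turns the mean over [A] into the mean over [B]. If the latter is
    at most [eps ^+ 2], Markov's inequality lets the former exceed [eps] with conditional
    probability at most [eps]. *)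
Lemma small_avg_subset (I : finType) (f : cube I -> R) (A B : {set I}) (eps :
  R) :
  (forall x, 0 <= f x) -> 0 < eps -> A \subset B ->
  (1 - eps) * unif_exp (fun x => (avg B f x <= eps ^+ 2)%R%:R) <=
  unif_exp (fun x => (avg A f x <= eps)%R%:R).
Proof.
move=> f0 e0 AB; pose c x : R := (avg B f x <= eps ^+ 2)%R%:R.
have cB : indep B c.
  by move=> x y; rewrite /c (indep_avg f (fintype.subxx B)).
have h1 : unif_exp (fun x => c x * avg A f x) <= eps ^+ 2 * unif_exp c.
  rewrite -(unif_exp_avg B) -unif_expZ; apply: le_unif_exp => x.
  rewrite avgM // avg_avg (finset.setUidPl AB) /c.
  by case: (leP (avg B f x)) => h /=; rewrite ?(mul0r, mulr0, mulr1, mul1r).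
have h2 : unif_exp c <= unif_exp (fun x => (avg A f x <= eps)%R%:R)
    + eps^-1 * unif_exp (fun x => c x * avg A f x).
  rewrite -unif_expZ -unif_expD; apply: le_unif_exp => x.
  have X0 : 0 <= avg A f x by apply: avg_ge0.
  have c0 : 0 <= c x by rewrite ler0n.
  have c1 : c x <= 1 by rewrite /c lern1 leq_b1.
  case: (leP (avg A f x) eps) => h /=.
    have : 0 <= eps^-1 * (c x * avg A f x).
      by apply: mulr_ge0; [rewrite invr_ge0 ltW|apply: mulr_ge0].
    by move: c1; lra.
  by rewrite add0r mulrCA ler_peMr // ler_pdivlMl // mulr1 ltW.
have := h2; have h3 : eps^-1 * unif_exp (fun x =>
  c x * avg A f x) <= eps * unif_exp c.
  by rewrite ler_pdivrMl // mulrA -expr2.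
rewrite mulrBl mul1r -/c; lra.
Qed.

End SmallRestrictedMeans.

(** * From independent memberships to alive sets of exact size *)

Section UniformSets.
Set Implicit Arguments.
Unset Strict Implicit.
Variables (R : realFieldType) (I : finType).
Implicit Types (A B : {set I}) (F G : {set I} -> R).

Definition set_mean k F : R :=
  (\sum_(A : {set I} | #|A| == k) F A) / #|[set A : {set I} | #|A| == k]|%:R.

(** List each set before its complement and match the two lists position by position. *)
Lemma perm_imset_eq A B : #|A| = #|B| -> exists p : {perm I}, p @: A = B.
Proof.
move=> AB; pose sA := enum A ++ enum (~: A); pose sB := enum B ++ enum (~: B).
have uniqs (C : {set I}) : uniq (enum C ++ enum (~: C)).
  rewrite cat_uniq !enum_uniq andbT /=; apply/hasPn => x.
  by rewrite !mem_enum inE.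
have mems (C : {set I}) x : x \in enum C ++ enum (~: C).
  by rewrite mem_cat !mem_enum inE orbN.
have sizes (C : {set I}) : size (enum C ++ enum (~: C)) = #|I|.
  by rewrite size_cat -!cardE cardsC.
pose q x := nth x sB (index x sA).
have iA x : (index x sA < size sB)%N by rewrite sizes -(sizes A) index_mem mems.
have qinj : injective q.
  move=> x y; rewrite /q (set_nth_default x y (iA y)) => /eqP.
  rewrite nth_uniq ?uniqs ?iA // => /eqP E.
  by rewrite -(nth_index x (mems A x)) -/sA E nth_index ?mems.
exists (perm qinj); apply/eqP; rewrite eqEcard card_imset; last exact: perm_inj.
rewrite AB leqnn andbT; apply/fintype.subsetP => _ /imsetP[x xA ->].
rewrite permE /q; have h : (index x sA < #|B|)%N.
  by rewrite /sA index_cat mem_enum xA -AB cardE index_mem mem_enum.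
rewrite /sB nth_cat -cardE h -(mem_enum B) mem_nth // -cardE //.
Qed.

(** A uniform permutation sends a fixed set of size [k] to a uniform set of size [k]. *)
Lemma sum_perm_imset k F A : #|A| = k ->
  \sum_(p : {perm I}) F (p @: A) = #|{perm I}|%:R * set_mean k F.
Proof.
move=> Ak; set c := \sum_p _.
have cE B : #|B| = k -> \sum_(p : {perm I}) F (p @: B) = c.
  move=> Bk; have [q qA] := perm_imset_eq (etrans Ak (esym Bk)).
  rewrite /c [RHS](reindex_inj (mulgI q)) /=; apply: eq_bigr => p _.
  rewrite -qA -imset_comp; congr (F _); apply: eq_imset => x /=.
  by rewrite permM.
have E : \sum_(B : {set I} | #|B| == k) \sum_(p : {perm I}) F (p @: B) =
    #|{perm I}|%:R * \sum_(B : {set I} | #|B| == k) F B.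
  rewrite exchange_big /= mulr_natl -sumr_const; apply: eq_bigr => p _.
  rewrite [RHS](reindex_inj (imset_inj (@perm_inj _ p))) /=.
  by apply: eq_bigl => B; rewrite card_imset //; apply: perm_inj.
have : c * #|[set B : {set I} | #|B| == k]|%:R =
    #|{perm I}|%:R * \sum_(B : {set I} | #|B| == k) F B.
  rewrite -E (eq_bigr (fun=> c)) => [|B /eqP]; last exact: cE.
  by rewrite sumr_const mulr_natr; congr (_ *+ _); rewrite cardsE.
rewrite /set_mean mulrA => <-; rewrite mulfK // pnatr_eq0 cards_eq0.
by apply/finset.set0Pn; exists A; rewrite inE Ak.
Qed.

Lemma exists_superset A k : (#|A| <= k)%N -> (k <= #|I|)%N ->
  exists2 B : {set I}, A \subset B & #|B| = k.
Proof.
elim: k => [|k IHk]; first by rewrite leqn0 => /eqP A0 _; exists A.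
rewrite leq_eqVlt ltnS => /orP[/eqP AE _|Ak kI]; first by exists A.
have [B AB Bk] := IHk Ak (ltnW kI).
have : ~: B != finset.set0
  by rewrite -card_gt0 cardsCs finset.setCK Bk subn_gt0.
case/finset.set0Pn => i; rewrite inE => iB; exists (i |: B).
  exact: fintype.subset_trans AB (finset.subsetUr _ _).
by rewrite cardsU1 iB Bk.
Qed.

(** The union of the three sets has mean size at most [k / 2]. When it has at most [k] elements it
    extends to a set of size [k]; one random permutation applied to both makes the larger one
    uniform and preserves the inclusion. *)
Lemma set_mean_le_bern3 (s q : R) k F G : 0 <= s -> s <= 1 -> 0 <= q ->
  (k <= #|I|)%N -> 6 * s * #|I|%:R <= k%:R ->
  (forall A, 0 <= F A) -> (forall A, 0 <= G A) ->
  (forall A B, A \subset B -> q * G B <= F A) ->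
  q / 2 * set_mean k G <=
  bern s (fun L1 => bern s (fun L2 => bern s (fun L3 => F (L1 :|: L2 :|: L3)))).
Proof.
move=> s0 s1 q0 kI sk F0 G0 FG; set T := bern s _.
have M0 : 0 <= set_mean k G by rewrite divr_ge0 ?sumr_ge0.
pose P : R := #|{perm I}|%:R.
have P0 : 0 < P by rewrite ltr0n; apply/card_gt0P; exists 1%g.
have TP : P * T = bern s (fun L1 => bern s (fun L2 => bern s (fun L3 =>
    \sum_(p : {perm I}) F (p @: (L1 :|: L2 :|: L3))))).
  transitivity (\sum_(p : {perm I}) bern s (fun L1 => bern s (fun L2 =>
    bern s (fun L3 =>
    F (p @: (L1 :|: L2 :|: L3)))))); last first.
    rewrite -bern_sum; apply: eq_bern => L1; rewrite -bern_sum;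
      apply: eq_bern => L2.
    by rewrite -bern_sum.
  rewrite mulr_natl -sumr_const; apply: eq_bigr => p _.
  rewrite /T -(bern_imset s p); apply: eq_bern => L1.
  rewrite -(bern_imset s p); apply: eq_bern => L2.
  rewrite -(bern_imset s p); apply: eq_bern => L3.
  by rewrite !imsetU.
rewrite -(ler_pM2l P0) TP.
have card3 (L1 L2 L3 : {set I}) : #|L1 :|: L2 :|: L3|%:R <= #|L1|%:R + #|L2|%:R
  + #|L3|%:R :> R.
  by rewrite -!natrD ler_nat (leq_trans (leq_card_setU _ _)) // leq_add2r
    leq_card_setU.
(* A linear minorant of the indicator that the union has at most [k] elements: never above 1, and
   not positive from size [k.+1] on. Its mean needs only the mean sizes. *)
pose w (L1 L2 L3 : {set I}) : R := 1 - (k.+1%:R)^-1 * (#|L1|%:R + #|L2|%:R +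
  #|L3|%:R).
have k0 : 0 < k.+1%:R :> R by rewrite ltr0n.
have PqM : 0 <= P * (q * set_mean k G)
  by rewrite mulr_ge0 ?(ltW P0) // mulr_ge0.
apply: (@le_trans _ _ (bern s (fun L1 => bern s (fun L2 => bern s (fun L3 =>
    P * (q * set_mean k G) * w L1 L2 L3))))); last first.
  apply: le_bern => // L1; apply: le_bern => // L2; apply: le_bern => // L3.
  set A := L1 :|: L2 :|: L3.
  have [Ak|kA] := leqP #|A| k.
    have [B AB Bk] := exists_superset Ak kI.
    apply: (@le_trans _ _ (P * (q * set_mean k G))).
      rewrite ler_piMr // gerBl; apply: mulr_ge0; first by rewrite invr_ge0 ltW.
      by apply: addr_ge0 => //; apply: addr_ge0.
    rewrite mulrCA -(sum_perm_imset G Bk) mulr_sumr; apply: ler_sum => p _.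
    by apply: FG; apply: imsetS.
  apply: (@le_trans _ _ 0); last by apply: sumr_ge0.
  rewrite mulr_ge0_le0 // subr_le0 ler_pdivlMl // mulr1.
  by apply: le_trans (card3 L1 L2 L3); rewrite ler_nat.
have -> : bern s (fun L1 => bern s (fun L2 => bern s (fun L3 =>
    P * (q * set_mean k G) * w L1 L2 L3))) =
    P * (q * set_mean k G) * (1 - (k.+1%:R)^-1 * (3 * (s * #|I|%:R))).
  have lin (a b : R) (H : {set I} -> R) : bern s (fun L =>
    a + b * H L) = a + b * bern s H.
    by rewrite bernD bern_cst bernZ.
  set c := P * (q * _); set d := k.+1%:R^-1.
  have -> : (fun L1 => bern s (fun L2 => bern s (fun L3 => c * w L1 L2 L3))) =
    (fun L1 => (c - c * d * (2 * (s * #|I|%:R))) + (- (c * d)) * #|L1|%:R).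
    apply/funext => L1.
    rewrite (@eq_bern _ _ _ _ (fun L2 =>
      (c - c * d * (#|L1|%:R + s * #|I|%:R)) + (- (c * d)) * #|L2|%:R)).
      by rewrite lin bern_card; ring.
    move=> L2; rewrite (@eq_bern _ _ _ _ (fun L3 =>
      (c - c * d * (#|L1|%:R + #|L2|%:R)) + (- (c * d)) * #|L3|%:R)).
      by rewrite lin bern_card; ring.
    by move=> L3; rewrite /w -/d; ring.
  by rewrite lin bern_card; ring.
have h : 1 / 2 <= 1 - (k.+1%:R)^-1 * (3 * (s * #|I|%:R)).
  have : (k.+1%:R)^-1 * (3 * (s * #|I|%:R)) <= 1 / 2.
    by rewrite ler_pdivrMl // -natr1; lra.
  by set X := _^-1 * _; lra.
have := ler_wpM2l PqM h; apply: le_trans.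
by rewrite le_eqVlt; apply/orP; left; apply/eqP; field.
Qed.

End UniformSets.

(** * Restrictions as averages, and the variance of Boolean functions *)

Section RestrictedVariance.
Set Implicit Arguments.
Unset Strict Implicit.
Variables (R : realFieldType) (I : finType).
Implicit Types (A : {set I}) (x : cube I) (F : cube I -> R).

Definition proj (P : pred I) x : cube {i : I | P i} := [ffun j => x (val j)].

Lemma merge_proj A x :
  Defs.merge (proj (fun i => i \in A) x) (proj (fun i => i \notin A) x) = x.
Proof.
by apply/ffunP => i; rewrite !ffunE; case: {-}_ / boolP => iA; rewrite ffunE.
Qed.

Lemma proj_merge A (y : cube {i : I | i \in A}) (z : cube {i : I | i \notin A})
  :
  proj (fun i => i \in A) (Defs.merge y z) = y.
Proof.
apply/ffunP => -[i iA]; rewrite !ffunE /=; case: {-}_ / boolP => h.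
  by congr (y _); apply: val_inj.
by exfalso; move: (h); rewrite iA.
Qed.

Lemma projC_merge A (y : cube {i : I | i \in A}) (z : cube {i : I | i \notin
  A}) :
  proj (fun i => i \notin A) (Defs.merge y z) = z.
Proof.
apply/ffunP => -[i iA]; rewrite !ffunE /=; case: {-}_ / boolP => h.
  by exfalso; move: (iA); rewrite h.
by congr (z _); apply: val_inj.
Qed.

Lemma mix_merge A x y :
  mix A x y = Defs.merge (proj (fun i => i \in A) y) (proj (fun i =>
    i \notin A) x).
Proof.
by apply/ffunP => i; rewrite !ffunE; case: {-}_ / boolP => iA;
  rewrite ffunE ?iA ?(negPf iA).
Qed.

Lemma sum_cube_merge A (G : cube {i : I | i \in A} -> cube {i : I | i \notin A}
  -> R) :
  \sum_(x : cube I) G (proj (fun i => i \in A) x) (proj (fun i =>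
    i \notin A) x) =
  \sum_y \sum_z G y z.
Proof.
rewrite pair_bigA /= (reindex (fun p : cube {i : I | i \in A} * cube {i : I | i
  \notin A} =>
  Defs.merge p.1 p.2)) /=; last first.
  exists (fun x => (proj (fun i => i \in A) x, proj (fun i => i \notin A) x)).
    by move=> [y z] _ /=; rewrite proj_merge projC_merge.
  by move=> x _ /=; rewrite merge_proj.
by apply: eq_bigr => -[y z] _ /=; rewrite proj_merge projC_merge.
Qed.

Lemma card_cubeM A :
  #|cube I|%:R = #|cube {i : I | i \in A}|%:R * #|cube {i : I | i \notin A}|%:R
    :> R.
Proof.
have := sum_cube_merge (fun (_ : cube {i : I | i \in A}) (_ : cube {i : I | i
  \notin A}) => 1).
by rewrite !sumr_const -mulrnA => ->; rewrite -natrM mulnC.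
Qed.

Lemma unif_exp_proj A (H : cube {i : I | i \in A} -> R) :
  unif_exp (fun x => H (proj (fun i => i \in A) x)) = unif_exp H.
Proof.
rewrite /unif_exp (sum_cube_merge (fun y _ => H y)) (card_cubeM A).
under eq_bigr do rewrite sumr_const -mulr_natr.
by rewrite -mulr_suml -mulf_div divff ?mulr1 // card_cube_neq0.
Qed.

Lemma unif_exp_projC A (H : cube {i : I | i \notin A} -> R) :
  unif_exp (fun x => H (proj (fun i => i \notin A) x)) = unif_exp H.
Proof.
rewrite /unif_exp (sum_cube_merge (fun _ z => H z)) (card_cubeM A).
rewrite sumr_const -[_ *+ _]mulr_natl.
by rewrite -mulf_div divff ?mul1r // card_cube_neq0.
Qed.

Lemma unif_exp_restrict A F x :
  unif_exp (Defs.restrict F (proj (fun i => i \notin A) x)) = avg A F x.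
Proof.
rewrite -unif_exp_proj /avg; apply: eq_unif_exp => y.
by rewrite /Defs.restrict mix_merge.
Qed.

Lemma unif_probE (T : finType) (E : pred T) :
  unif_prob R E = unif_exp (fun t => (E t)%:R).
Proof.
rewrite /unif_prob /unif_exp -sum1_card natr_sum big_mkcond; congr (_ / _).
by apply: eq_bigr => t _; rewrite -topredE /=; case: (E t).
Qed.

Lemma unif_var_bool (T : finType) (h : T -> bool) : (0 < #|T|)%N ->
  unif_var (realf R h) =
  unif_exp (realf R h) * (1 - unif_exp (realf R h)).
Proof.
move=> T0; rewrite /unif_var; set m := unif_exp (realf R h).
transitivity (unif_exp (fun t => (1 - 2 * m) * realf R h t + m ^+ 2)).
  by apply: eq_unif_exp => t; rewrite /realf; case: (h t) => /=; ring.
by rewrite unif_expD unif_expZ unif_exp_cst // -/m; ring.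
Qed.

(** A Boolean restriction of mean [m] has variance [m * (1 - m)]. One of the two factors is at least
    [1 / 2], so the other is at most [2 * v]. *)
Lemma restr_prob_var_le (f : cube I -> bool) k (v : R) :
  restr_prob (realf R f) k (fun A h => unif_var h <= v) <=
  set_mean k (fun A => unif_exp (fun x => (avg A (realf R f) x <= 2 * v)%R%:R))
  + set_mean k (fun A => unif_exp (fun x =>
      (avg A (fun y => 1 - realf R f y) x <= 2 * v)%R%:R)).
Proof.
rewrite /restr_prob /set_mean -mulrDl ler_wpM2r ?invr_ge0 ?ler0n // -big_split
  /=.
apply: ler_sum => A _; rewrite unif_probE -unif_exp_projC -unif_expD.
apply: le_unif_exp => x; set z := proj _ x.
have -> : unif_var (Defs.restrict (realf R f) z) =
    avg A (realf R f) x * (1 - avg A (realf R f) x).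
  rewrite -unif_exp_restrict -/z.
  exact: (unif_var_bool (fun y => f (Defs.merge y z)) (card_cube_gt0 _)).
rewrite avgB avg_cst; set m := avg A _ x.
have m0 : 0 <= m by apply: avg_ge0 => y; rewrite /realf ler0n.
have m1 : m <= 1 by apply: avg_le1 => y; rewrite /realf lern1 leq_b1.
case: (leP (m * (1 - m)) v) => h; last by rewrite addr_ge0 ?ler0n.
have [hm|hm] := leP m (1 / 2).
  have -> : m <= 2 * v by nra.
  by rewrite lerDl ler0n.
have -> : 1 - m <= 2 * v by nra.
by rewrite lerDr ler0n.
Qed.

Lemma fourier0 F : fourier F finset.set0 = unif_exp F.
Proof. by rewrite /fourier; apply: eq_unif_exp => x;
  rewrite /chi big_set0 mulr1. Qed.

Lemma max_inf_ge0 F : 0 <= max_inf F.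
Proof. by apply/bigmax_geP; left. Qed.

(** If all influences vanish, so do the coefficients of nonempty sets; then Parseval gives
    [m = m ^+ 2], and the variance is 0. *)
Lemma max_inf_gt0 (f : cube I -> bool) :
  0 < unif_var (realf R f) -> 0 < max_inf (realf R f).
Proof.
rewrite unif_var_bool ?card_cube_gt0 // => V0.
rewrite lt_neqAle max_inf_ge0 andbT eq_sym; apply: contraTneq V0 => M0.
set m := unif_exp _; suff mm : m = m ^+ 2
  by rewrite -leNgt mulrBr mulr1 -expr2 -mm subrr.
have {1}-> : m = unif_exp (fun x => realf R f x ^+ 2).
  by apply: eq_unif_exp => x; rewrite /realf; case: (f x);
    rewrite ?expr0n ?expr1n.
rewrite Parseval (bigD1 finset.set0) //= fourier0 big1 ?addr0 // =>
  S /finset.set0Pn[i iS].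
apply/eqP; rewrite eq_le sqr_ge0 andbT -M0.
apply: le_trans (influence_le_max_inf _ i);
  rewrite /influence (bigD1 S) //= lerDl.
by apply: sumr_ge0 => T _; apply: sqr_ge0.
Qed.

Lemma max_inf_complement F : max_inf (fun x => 1 - F x) = max_inf F.
Proof.
apply: eq_bigr => i _; rewrite -!unif_exp_deriv_sqr; apply: eq_unif_exp => x.
by rewrite /coord_deriv avgB avg_cst; ring.
Qed.

End RestrictedVariance.

(** * Choice of the parameters and numerical estimates *)

Section NumericalBounds.
Set Implicit Arguments.
Unset Strict Implicit.
Variable R : realType.

(** As [ln 2 <= 1] and [ln (e / rho) >= 1], the exponential is at most [y / (8 * e)] to the power
    [960 / rho]; it remains to compare powers. *)
Lemma expR_log_bound (rho y : R) (N : nat) :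
  0 < rho -> rho <= 1 -> 0 < y -> y <= 1 / 4 -> N%:R <= 73 / rho ->
  2 * expR (- (960 / rho * ln (expR 1 / rho) * log2 (8 * expR 1 / y))) <=
  ((y / 64) ^+ N.+1 / 2) ^+ 2.
Proof.
move=> rho0 rho1 y0 y1 Nrho.
have e2 : 2 <= expR 1 :> R by have := @expR_ge1Dx R 1; lra.
have e0 : 0 < expR 1 :> R by apply: expR_gt0.
set a := y / (8 * expR 1); set b := y / 64.
have a0 : 0 < a by rewrite divr_gt0 // mulr_gt0.
have b0 : 0 < b by rewrite divr_gt0.
have b1 : b <= 1 / 256 by rewrite /b; lra.
have ab : a <= 4 * b.
  rewrite /a ler_pdivrMr ?mulr_gt0 // /b; nra.
have a1 : a < 1 by lra.
have la : ln a < 0 by rewrite ln_lt0 // a0.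
have lnrho : 1 <= ln (expR 1 / rho).
  rewrite ln_div ?posrE // expRK lerBrDr gerDl.
  by rewrite ln_le0.
have ln20 : 0 < ln 2 :> R by rewrite ln_gt0 // ltr1n.
have ln21 : ln 2 <= 1 :> R.
  have -> : 2 = 1 + 1 :> R by ring.
  by apply: le_ln1Dx; lra.
have log2a : - ln a <= log2 (8 * expR 1 / y).
  have -> : 8 * expR 1 / y = a^-1 by rewrite /a invf_div.
  rewrite /log2 lnV ?posrE // ler_pdivlMr // ler_piMr // oppr_ge0 ltW //.
(* The outer 2 serves [a ^+ 2 <= b]; [2 * N + 3] leaves one spare factor [b], which absorbs the
   constants. Since [N <= 73 / rho], [m] is at most [298 / rho]. *)
pose m := (2 * (2 * N + 3))%N.
have mrho : m%:R <= 960 / rho.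
  have rV : 1 <= rho^-1 by rewrite invf_ge1.
  rewrite /m natrM natrD natrM; move: Nrho rV; set w := rho^-1; lra.
have expo : expR (- (960 / rho * ln (expR 1 / rho) * log2 (8 * expR 1 / y))) <=
  a ^+ m.
  rewrite -[a in leRHS]lnK ?posrE // -expRM_natl ler_expR.
  rewrite lerNl -mulrN; apply: ler_pM => //; first by rewrite oppr_ge0 ltW.
  apply: (le_trans mrho); apply: ler_peMr lnrho.
  by apply: divr_ge0; [apply: ler0n|apply: ltW].
have a2b : a ^+ 2 <= b.
  have : a ^+ 2 <= (4 * b) ^+ 2
    by rewrite ler_sqr ?nnegrE ?(ltW a0) // mulr_ge0 // ltW.
  nra.
have am : a ^+ m <= b ^+ (2 * N + 3).
  by rewrite /m exprM lerXn2r // nnegrE ?sqr_ge0 ?(ltW b0).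
have -> : (b ^+ N.+1 / 2) ^+ 2 = b ^+ (2 * N + 2) / 4.
  rewrite expr_div_n -exprM; congr (b ^+ _ / _); last by ring.
  by rewrite mulnC mulnSr.
have bE : b ^+ (2 * N + 3) = b * b ^+ (2 * N + 2) by rewrite -exprS -addnS.
have B0 : 0 <= b ^+ (2 * N + 2) by rewrite exprn_ge0 // ltW.
move: expo am; rewrite bE; set B := b ^+ _ in B0 *; set E := expR (- _);
  set A := a ^+ m.
nra.
Qed.

(** Each of the three error terms of [bern3_small_avg] is at most [p / 64]. With its factor 2 and
    [(1 - eps) / 2 >= 1 / 4], the total is at most [3 * p / 8]. *)
Lemma set_mean_small_avg n (f : cube 'I_n -> R) k (tau rho p V : R) :
  (forall x, 0 <= f x <= 1) -> V <= unif_exp f -> 0 < V -> V <= 1 / 4 ->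
  max_inf f <= tau -> 0 <= tau -> tau <= 1 -> 0 < rho -> rho <= 1 ->
  0 < p -> p <= 1 -> 8 * tau `^ (rho / 960) <= rho * (p * V) ->
  (k <= n)%N -> rho * n%:R <= k%:R ->
  set_mean k (fun A => unif_exp (fun x => (avg A f x <= 2 *
    expR (- (960 / rho * ln (expR 1 / rho) * log2 (8 * expR 1 / (p *
      V)))))%R%:R))
  <= p / 2.
Proof.
move=> f01 Vmu V0 V4 ftau tau0 tau1 rho0 rho1 p0 p1 tauP kn rhon.
set v := expR _; set mu := unif_exp f; have mu0 : 0 < mu := lt_le_trans V0 Vmu.
set y := p * V; have y0 : 0 < y by rewrite mulr_gt0.
have y4 : y <= 1 / 4 by rewrite /y; nra.
(* [s] gives [6 * s * n <= k], [eta] is the largest step that [bern3_small_avg] allows, and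
   [N > 72 / rho] gives [12 <= s * N]. *)
pose s := rho / 6; pose delta := y / 64; pose eta := s * delta / 2.
pose S := delta^-1; pose N := (Num.truncn (72 / rho)).+1.
have d0 : 0 < delta by rewrite divr_gt0.
have s0 : 0 < s by rewrite divr_gt0.
have s1 : s <= 1 by rewrite /s; lra.
have d1 : delta <= 1 by rewrite /delta; lra.
have e0 : 0 < eta by rewrite divr_gt0 // mulr_gt0.
have e1 : eta <= 1 by rewrite /eta; nra.
have S0 : 0 < S by rewrite invr_gt0.
have rV : 1 <= rho^-1 by rewrite invf_ge1.
have q0 : 0 <= 72 / rho by rewrite divr_ge0 // ltW.
have /andP[Nl Nu] := truncn_itv q0; rewrite -/N in Nu.
have N73 : N%:R <= 73 / rho by rewrite /N -natr1; clear - Nl rV; lra.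
have sN : 12 <= s * N%:R.
  have : 72 <= N%:R * rho by rewrite -ler_pdivrMr // ltW.
  by clear; rewrite /s; lra.
have N0 : (0 < N)%N by rewrite /N.
(* Solves [2 * S ^+ N * eps = delta]. *)
pose eps := delta ^+ N.+1 / 2.
have eps0 : 0 < eps by rewrite divr_gt0 // exprn_gt0.
have eps1 : eps <= 1 / 2.
  by rewrite /eps ler_pM2r // exprn_ile1 // ltW.
have Se : 2 * S ^+ N * eps <= delta.
  by rewrite le_eqVlt; apply/orP; left; apply/eqP;
    rewrite /S /eps exprS exprVn; field;
    rewrite expf_neq0 // gt_eqF.
have small : 2 * v <= eps ^+ 2 by exact: expR_log_bound.
have main := bern3_small_avg f01 mu0 ftau s0 s1 d0 e0 e1 (lexx _) N0 sN S0 Se.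
pose F A := unif_exp (fun x => (avg A f x <= eps)%R%:R : R).
pose G A := unif_exp (fun x => (avg A f x <= eps ^+ 2)%R%:R : R).
have FG (A B : {set 'I_n}) : A \subset B -> (1 - eps) * G B <= F A.
  by move=> AB; apply: small_avg_subset => // x; case/andP: (f01 x).
have F0 A : 0 <= F A by apply: ge0_unif_exp.
have G0 A : 0 <= G A by apply: ge0_unif_exp.
have cardI : 6 * s * #|'I_n|%:R <= k%:R by rewrite card_ord; clear - rhon;
  rewrite /s; lra.
have kI : (k <= #|'I_n|)%N by rewrite card_ord.
have q1 : 0 <= 1 - eps by clear - eps1; lra.
have := le_trans (set_mean_le_bern3 (ltW s0) s1 q1 kI cardI F0 G0 FG) main.
set M := set_mean k G => hM.
have M0 : 0 <= M by rewrite divr_ge0 ?sumr_ge0.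
apply: (@le_trans _ _ M).
  rewrite /M /set_mean ler_wpM2r ?invr_ge0 //; apply: ler_sum => A _.
  apply: le_unif_exp => x; case: (leP (avg A f x) (2 * v)) => // h.
  by rewrite (le_trans h small).
have dle t : V <= t -> delta <= p / 64 * t.
  by move=> Vt; rewrite /delta /y mulrAC ler_wpM2l // divr_ge0 // ltW.
have t1 : delta / mu <= p / 64 by rewrite ler_pdivrMr // dle.
have t3 : (S * Num.sqrt mu)^-1 <= p / 64.
  have mu1 : mu <= 1.
    by rewrite /mu -(avg_setT f [ffun=> false]); apply: avg_le1 => x;
      case/andP: (f01 x).
  have sq : V <= Num.sqrt mu.
    apply: (le_trans Vmu); rewrite -[leLHS]sqr_sqrtr ?(ltW mu0) // expr2.
    by rewrite ler_piMr ?sqrtr_ge0 // -[leRHS]sqrtr1 ler_wsqrtr.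
  have sq0 : 0 < Num.sqrt mu by rewrite sqrtr_gt0.
  by rewrite invfM invrK ler_pdivrMr // dle.
pose th := tau `^ (rho / 960).
have th0 : 0 <= th by apply: powR_ge0.
have thP : th <= rho * y / 8 by move: tauP; rewrite -/th -/y; clear; lra.
have th32 : th <= 1 / 32.
  have : rho * y <= y by rewrite ler_piMl // ltW.
  by clear - thP y4; lra.
have th40 : tau `^ (s / 4) = th ^+ 40.
  by rewrite /th -powR_mulrn ?powR_ge0 // -powRrM; congr (_ `^ _); rewrite /s;
    field.
have t2 : tau `^ (s / 4) / (s * eta ^+ 4) / mu <= p / 64.
  have z0 : 0 < rho * y by rewrite mulr_gt0.
  have e4 : s * eta ^+ 4 * V = (rho * y) ^+ 5 / (6 * 768 ^+ 4) / p.
    by rewrite /eta /delta /s /y; field; rewrite gt_eqF.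
  (* Of the 40 powers of [th], five match the factor [(rho * y) ^+ 5] of [e4], seven, each at most
     [1 / 32], cover the constants, and the others are at most 1. *)
  have th12 : th ^+ 40 <= (rho * y / 8) ^+ 5 * (1 / 32) ^+ 7.
    apply: (@le_trans _ _ (th ^+ 12)); first by rewrite ler_wiXn2l //;
      clear - th32; lra.
    rewrite (exprD th 5 7); apply: ler_pM; rewrite ?exprn_ge0 //.
      by rewrite lerXn2r ?nnegrE // divr_ge0 // ltW.
    by rewrite lerXn2r // nnegrE // divr_ge0.
  have se0 : 0 < s * eta ^+ 4 by rewrite mulr_gt0 // exprn_gt0.
  have sm0 : 0 < s * eta ^+ 4 * mu := mulr_gt0 se0 mu0.
  rewrite th40 -mulrA -invfM ler_pdivrMr //.
  apply: (@le_trans _ _ (p / 64 * (s * eta ^+ 4 * V))); last first.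
    by rewrite ler_wpM2l ?divr_ge0 ?(ltW p0) // ler_pM2l.
  apply: (le_trans th12); rewrite e4.
  have -> : p / 64 * ((rho * y) ^+ 5 / (6 * 768 ^+ 4) / p) =
    (rho * y) ^+ 5 * (1 / (64 * (6 * 768 ^+ 4))) by field; rewrite gt_eqF.
  have -> : (rho * y / 8) ^+ 5 * (1 / 32) ^+ 7 = (rho * y) ^+ 5 * (1 / 8 ^+ 5 *
    (1 / 32) ^+ 7) by field.
  rewrite ler_wpM2l ?exprn_ge0 ?(ltW z0) //; clear; lra.
have hM' : 1 / 4 * M <= (1 - eps) / 2 * M by rewrite ler_wpM2r //;
  clear - eps1; lra.
move: hM; rewrite -/mu (mulrDl delta); move: t1 t2 t3.
set T1 := delta / mu; set T2 := _ / mu; set T3 := (S * _)^-1;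
  set E := _ * M in hM' *; clear - hM' p0; lra.
Qed.

End NumericalBounds.

(** * The bound for a single function, and the theorem *)

Section SmallRestrictedVariance.
Set Implicit Arguments.
Unset Strict Implicit.
Variable R : realType.

(** [1 / M > C > e] gives [ln (1 / M) > 1], so the iterated logarithm, and with it the lower bound
    on [rho], is positive. *)
Lemma exponent_bound_gt0 (C V M rho : R) :
  expR 1 < C -> 0 < V -> 0 < M -> M < 1 / C ->
  C / V * (ln (ln (1 / M)) / ln (1 / M)) <= rho -> 0 < rho.
Proof.
move=> eC V0 M0 MC; apply: lt_le_trans.
have C0 : 0 < C := lt_trans (expR_gt0 _) eC.
have CM : C < 1 / M by rewrite ltr_pdivlMr // mulrC -ltr_pdivlMr.
have l1 : 1 < ln (1 / M).
  by rewrite -[ltLHS](expRK 1) ltr_ln ?posrE ?expR_gt0 ?divr_gt0 // (lt_trans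
    eC).
apply: mulr_gt0; first exact: divr_gt0.
by apply: divr_gt0; [rewrite ln_gt0|apply: lt_trans l1].
Qed.

(** The cases of a small mean of [f] and of [1 - f] cost [p / 2] each. Both functions have the same
    influences, and [V = mu * (1 - mu)] is a lower bound for both means. *)
Lemma restr_prob_small_variance n (f : cube 'I_n -> bool) (M V rho p : R) :
  M = max_inf (realf R f) -> V = unif_var (realf R f) -> 0 < V -> M < 1 / 960 ->
  960 / V * (ln (ln (1 / M)) / ln (1 / M)) <= rho -> rho <= 1 ->
  8 * M `^ (rho / 960) / (rho * V) <= p -> p <= 1 ->
  restr_prob (realf R f) `|Num.ceil (rho * n%:R)|%N
    (fun A h => unif_var h <=
      expR (- (960 / rho * ln (expR 1 / rho) * log2 (8 * expR 1 / (p * V)))))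
        <= p.
Proof.
move=> ME VE V0 MC rhol rho1 pl p1.
have M0 : 0 < M by rewrite ME; apply: max_inf_gt0; rewrite -VE.
have e4 : expR 1 <= 4 :> R.
  have h : 1 / 2 <= expR (- (1 / 2)) :> R
    by have := @expR_ge1Dx R (- (1 / 2)); lra.
  have -> : expR 1 = (expR (- (1 / 2)) ^+ 2)^-1 :> R.
    by rewrite -expRM_natl -expRN; congr expR; field.
  rewrite -[leRHS]invrK lef_pV2 ?posrE ?invr_gt0 ?exprn_gt0 ?expR_gt0 //; nra.
have C1 : expR 1 < 960 :> R by apply: le_lt_trans e4 _; rewrite ltr_nat.
have rho0 : 0 < rho := exponent_bound_gt0 C1 V0 M0 MC rhol.
have th0 : 0 < M `^ (rho / 960) by apply: powR_gt0.
have p0 : 0 < p.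
  by apply: lt_le_trans _ pl; apply: divr_gt0;
    [exact: mulr_gt0|exact: mulr_gt0 rho0 V0].
have tauP : 8 * M `^ (rho / 960) <= rho * (p * V).
  move: pl; rewrite ler_pdivrMr ?(mulr_gt0 rho0 V0) //; clear; lra.
set mu := unif_exp (realf R f).
have VmuE : V = mu * (1 - mu).
  by rewrite VE; apply: unif_var_bool; apply: card_cube_gt0.
have V4 : V <= 1 / 4 by rewrite VmuE; have := sqr_ge0 (mu - 1 / 2); clear; lra.
have F01 x : 0 <= realf R f x <= 1 by rewrite /realf ler0n lern1 leq_b1.
have muV : V <= mu by rewrite VmuE; have := sqr_ge0 mu; clear; lra.
have muV' : V <= 1 - mu by rewrite VmuE; have := sqr_ge0 (1 - mu); clear; lra.
have M1 : M <= 1 by apply: le_trans (ltW MC) _; clear; lra.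
set k := `|Num.ceil (rho * n%:R)|%N.
have rn0 : 0 <= rho * n%:R by rewrite mulr_ge0 // ltW.
have kE : k%:R = (Num.ceil (rho * n%:R))%:~R :> R.
  have c0 : 0 <= Num.ceil (rho * n%:R)
    by rewrite ceil_ge0 (lt_le_trans _ rn0) // ltrN10.
  by rewrite -[in RHS](gez0_abs c0).
have rk : rho * n%:R <= k%:R by rewrite kE; exact: ceil_ge.
have kn : (k <= n)%N.
  rewrite -(ler_nat R) kE -[n%:R]/(n%:Z%:~R) ler_int ceil_le_int.
  by rewrite ler_piMl.
apply: (le_trans (restr_prob_var_le _ _ _)).
rewrite [leRHS](splitr p); apply: lerD.
  apply: (set_mean_small_avg F01 muV V0 V4 _ (ltW M0) M1 rho0 rho1 p0 p1 tauP
    kn rk).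
  by rewrite ME.
apply: (set_mean_small_avg _ _ V0 V4 _ (ltW M0) M1 rho0 rho1 p0 p1 tauP kn rk).
- by move=> x; have := F01 x; lra.
- by rewrite unif_expB unif_exp_cst ?card_cube_gt0.
- by rewrite max_inf_complement ME.
Qed.

End SmallRestrictedVariance.

Local Open Scope classical_set_scope.

Theorem theorem4p1 (R : realType) :
  exists C : R, 1 < C /\
  forall f : forall n : nat, cube 'I_n -> bool,
  let M n : R := max_inf (realf R (f n)) in
  let V n : R := unif_var (realf R (f n)) in
  (forall n, M n < 1 / C) ->
  (exists g : nat -> R, g =o_\oo (fun n : nat => n%:R : R) /\
     \forall n \near \oo, V n = 2 `^ (- g n)) ->
  \forall n \near \oo, forall rho p : R,
    C / V n * (ln (ln (1 / M n)) / ln (1 / M n)) <= rho -> rho <= 1 ->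
    8 * M n `^ (rho / C) / (rho * V n) <= p -> p <= 1 ->
    restr_prob (realf R (f n)) `|Num.ceil (rho * n%:R)|%N
      (fun A h =>
         unif_var h <=
           expR (- (C / rho * ln (expR 1 / rho)
                    * log2 (8 * expR 1 / (p * V n)))))
      <= p.
Proof.
(* [960 = 24 * 40]: the gain has exponent [s / 4 = rho / 24], a 40th power of the quantity with
   exponent [rho / 960]. The constant also exceeds [e] and the 298 behind [expR_log_bound]. *)
exists 960; split; first by rewrite ltr1n.
move=> f M V MC [g [_ nearV]].
near=> n => rho p rhol rho1 pl p1.
have V0 : 0 < V n.
  have -> : V n = 2 `^ (- g n) by near: n.
  exact: powR_gt0.
exact: restr_prob_small_variance erefl erefl V0 (MC n) rhol rho1 pl p1.
Unshelve. all: by end_near.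
Qed.
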